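(* Consider the R-Xi-row iteration defined in the context, under the network, problem and noise assumptions stated there. For every sufficiently small $\epsilon>0$, the gains can be chosen of the form $$\lambda_k=\frac{c_\lambda}{(k+1)^p},\quad \gamma_k=\frac{c_\gamma}{(k+1)^q},\quad \alpha_k=\frac{c_\alpha}{(k+1)^a},\quad \beta_k=\frac{c_\beta}{(k+1)^b},$$ with $c_\lambda,c_\beta\in(0,1]$, $c_\gamma,c_\alpha>0$, $0<q<p<1$, $\frac12<b<a<1$, $a>2p-1$ and $2a-b>1$, such that, as $k\to\infty$, $$\mathbb E[F(\tilde x_k)-F(x^* )],\quad \mathbb E\big[\|\mathbf x_k-\mathbf 1\tilde x_k\|_A^2\big],\quad \mathbb E\big[\|\mathbf z_k-\mathbf 1\tilde z_k\|_A^2\big]\quad\text{are all } \mathcal O\big((k+1)^{-\frac13+\epsilon}\big).$$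
   Context: Setting (scalar decision variable). There are $n$ agents, $\mathcal V=\{1,\dots,n\}$, with functions $f_i:\mathbb R\to\mathbb R$, $F(x)=\frac1n\sum_{i=1}^n f_i(x)$, and $x^*$ denotes the minimizer of $F$. Network assumption: $W=[W_{ij}]\in\mathbb R^{n\times n}$ is a primitive nonnegative matrix with $W\mathbf 1=\mathbf 1$; here $W_{ij}\in(0,1)$ if $j=i$ or $j$ is an in-neighbor of $i$ in the communication digraph, and $W_{ij}=0$ otherwise. Let $\mathbf r=(r_1,\dots,r_n)^\top$ be the unique positive vector with $\mathbf r^\top W=\mathbf r^\top$ and $\mathbf r^\top\mathbf 1=1$. Problem assumption: each $f_i$ is $\mu$-strongly convex and $L$-smooth (differentiable with $L$-Lipschitz gradient) for some $\mu,L>0$. R-Xi-row iteration. Let $\{\lambda_k\},\{\gamma_k\},\{\alpha_k\},\{\beta_k\}$ be positive (deterministic) gain sequences and $\varepsilon_\kappa>0$ a fixed constant. Initialize with arbitrary $x_{i,0},z_{i,0}\in\mathbb R$, $\mathbf y_{i,0}\in\mathbb R^n$ equal to the $i$-th standard basis vector, and $\kappa_{i,-1}=0$. For $k=0,1,2,\dots$ and each $i\in\mathcal V$, set $\hat{\mathbf y}_{i,k}=\sum_{j}W_{ij}\mathbf y_{j,k}+\mathbf e^y_{i,k}$, $\hat z_{i,k}=\sum_jW_{ij}z_{j,k}+e^z_{i,k}$, $\hat x_{i,k}=\sum_jW_{ij}x_{j,k}+e^x_{i,k}$, and $$\mathbf y_{i,k+1}=(1-\lambda_k)\mathbf y_{i,k}+\lambda_k\hat{\mathbf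 y}_{i,k}+\gamma_k\mathbf y_{i,0},$$ $$\kappa_{i,k}=\frac{\sum_{j=1}^n[\mathbf y_{i,k+1}]_j}{n[\mathbf y_{i,k+1}]_i}\ \text{ if }[\mathbf y_{i,k+1}]_i>\varepsilon_\kappa,\qquad \kappa_{i,k}=\kappa_{i,k-1}\ \text{ otherwise},$$ $$z_{i,k+1}=(1-\beta_k)z_{i,k}+\beta_k\hat z_{i,k}+\alpha_k\kappa_{i,k}\nabla f_i(x_{i,k}),$$ $$x_{i,k+1}=(1-\beta_k)x_{i,k}+\beta_k\hat x_{i,k}-(z_{i,k+1}-z_{i,k}).$$ Here $e^x_{i,k},e^z_{i,k}$ are real random variables and $\mathbf e^y_{i,k}$ are $\mathbb R^n$-valued random vectors. Noise assumption: $e^x_{i,k},\mathbf e^y_{i,k},e^z_{i,k}$ are mutually independent over all $i\in\mathcal V$, $k\ge0$; all are zero-mean with variances uniformly bounded by a constant $\sigma>0$; moreover there is a constant $\tilde\sigma_y$ with $\|\mathbf e^y_{i,k}\|\le\tilde\sigma_y$ for all $i,k$ almost surely. Notation: $\mathbf x_k=(x_{1,k},\dots,x_{n,k})^\top$, $\mathbf z_k=(z_{1,k},\dots,z_{n,k})^\top$, $\tilde x_k=\mathbf r^\top\mathbf x_k$, $\tilde z_k=\mathbf r^\top\mathbf z_k$, $W_k=(1-\beta_k)I+\beta_kW$. Norm: $\|\mathbf x\|_A=\|\bar A\mathbf x\|_2$ on $\mathbb R^n$, where $\bar A\in\mathbb R^{n\times n}$ is a fixed nonsingular matrix chosen so that,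 for the induced matrix norm $\|M\|_A=\|\bar AM\bar A^{-1}\|_2$ and some $\rho_A>0$, $\|W_k-\mathbf 1\mathbf r^\top\|_A\le 1-\beta_k\rho_A<1$ for all $k$, and rescaled so that $\|\mathbf x\|_2\le\|\mathbf x\|_A$ for all $\mathbf x\in\mathbb R^n$. *)

(* Defs.v *)
From HB Require Import structures.
From mathcomp Require Import all_boot all_order all_algebra.
From mathcomp Require Import all_classical all_reals all_analysis.
Set Implicit Arguments.
Unset Strict Implicit.
Unset Printing Implicit Defensive.
Import Order.TTheory GRing.Theory Num.Theory.
Import numFieldNormedType.Exports.
Local Open Scope classical_set_scope.
Local Open Scope ring_scope.

(* The norm [`|_|] that the library puts on matrices is the maximum norm, so
   the Euclidean and spectral norms are introduced here. *)
Definition norm2 (R : realType) (n : nat) (v : 'cV[R]_n) : R :=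
  Num.sqrt (\sum_i v i 0 ^+ 2).

Definition opnorm2 (R : realType) (n : nat) (M : 'M[R]_n) : R :=
  sup [set norm2 (M *m v) | v in [set v : 'cV[R]_n | norm2 v <= 1]].

Definition normA (R : realType) (n : nat) (A : 'M[R]_n) (v : 'cV[R]_n) : R :=
  norm2 (A *m v).

Definition opnormA (R : realType) (n : nat) (A M : 'M[R]_n) : R :=
  opnorm2 (A *m M *m invmx A).

Definition ones (R : realType) (n : nat) : 'cV[R]_n := const_mx 1.

Definition primitive_mx (R : realType) (n : nat) (W : 'M[R]_n) : Prop :=
  (forall i j, 0 <= W i j) /\
  (exists2 m : nat, (0 < m)%N & forall i j, 0 < (W ^+ m) i j).

(* [N i j] means that j is an in-neighbor of i in the communication digraph. *)
Record network (R : realType) (n : nat) (N : rel 'I_n) (W : 'M[R]_n) : Prop :=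
  Network {
    network_primitive : primitive_mx W;
    network_stochastic : W *m ones R n = ones R n;
    network_edge : forall i j, (j == i) || N i j -> 0 < W i j < 1;
    network_nonedge : forall i j, ~~ ((j == i) || N i j) -> W i j = 0 }.

Record left_perron (R : realType) (n : nat) (W : 'M[R]_n) (r : 'cV[R]_n)
    : Prop := LeftPerron {
  perron_gt0 : forall i, 0 < r i 0;
  perron_fixed : r^T *m W = r^T;
  perron_sum1 : \sum_i r i 0 = 1 }.

Definition strongly_convex (R : realType) (mu : R) (f : R -> R) : Prop :=
  forall x y t : R, 0 <= t <= 1 ->
    f (t * x + (1 - t) * y) <=
      t * f x + (1 - t) * f y - mu / 2 * t * (1 - t) * (x - y) ^+ 2.

Definition smooth (R : realType) (L : R) (f : R -> R) : Prop :=
  (forall x, derivable f x 1) /\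
  (forall x y, `|derive1 f x - derive1 f y| <= L * `|x - y|).

Definition average (R : realType) (n : nat) (f : 'I_n -> R -> R) (x : R) : R :=
  n%:R^-1 * \sum_i f i x.

Definition minimizer (R : realType) (F : R -> R) (xs : R) : Prop :=
  forall x, F xs <= F x.

Record gains (R : realType) := Gains {
  lambda : nat -> R;
  gamma : nat -> R;
  alpha : nat -> R;
  beta : nat -> R }.

Definition poly_gain (R : realType) (c s : R) (k : nat) : R :=
  c / (k.+1%:R `^ s).

Definition Wk (R : realType) (n : nat) (W : 'M[R]_n) (g : gains R) (k : nat)
    : 'M[R]_n :=
  (1 - beta g k)%:M + beta g k *: W.

Record contractive_norm (R : realType) (n : nat) (W : 'M[R]_n) (r : 'cV[R]_n)
    (g : gains R) (A : 'M[R]_n) (rho : R) : Prop := ContractiveNorm {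
  contractive_unit : A \in unitmx;
  contractive_rho_gt0 : 0 < rho;
  contractive_bound : forall k,
    opnormA A (Wk W g k - ones R n *m r^T) <= 1 - beta g k * rho < 1;
  contractive_scale : forall v, norm2 v <= normA A v }.

(* Row i of [st_y] at time k is the vector y_{i,k}.  The entries of [st_kappa]
   at time k are kappa_{i,k-1}, matching the initialization kappa_{i,-1} = 0;
   kappa_{i,k} is the entry at time k.+1. *)
Record state (R : realType) (n : nat) := State {
  st_y : 'M[R]_n;
  st_kappa : 'cV[R]_n;
  st_z : 'cV[R]_n;
  st_x : 'cV[R]_n }.

(* Row i of the matrix [ey] is the realized value of the vector e^y_{i,k}. *)
Definition step (R : realType) (n : nat) (W : 'M[R]_n) (f : 'I_n -> R -> R)
    (epsk : R) (g : gains R) (k : nat) (ex : 'cV[R]_n) (ey : 'M[R]_n)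
    (ez : 'cV[R]_n) (s : state R n) : state R n :=
  let haty := W *m st_y s + ey in
  let hatz := W *m st_z s + ez in
  let hatx := W *m st_x s + ex in
  let y' := (1 - lambda g k) *: st_y s + lambda g k *: haty
            + gamma g k *: 1%:M in
  let kappa := \col_i (if epsk < y' i i
                       then (\sum_j y' i j) / (n%:R * y' i i)
                       else st_kappa s i 0) in
  let z' := (1 - beta g k) *: st_z s + beta g k *: hatz
            + alpha g k *: \col_i (kappa i 0 * derive1 (f i) (st_x s i 0)) in
  let x' := (1 - beta g k) *: st_x s + beta g k *: hatx - (z' - st_z s) in
  State y' kappa z' x'.

Fixpoint iterates (R : realType) (n : nat) (W : 'M[R]_n) (f : 'I_n -> R -> R)
    (epsk : R) (g : gains R) (x0 z0 : 'cV[R]_n)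
    (ex : nat -> 'cV[R]_n) (ey : nat -> 'M[R]_n) (ez : nat -> 'cV[R]_n)
    (k : nat) : state R n :=
  if k is k'.+1 then
    step W f epsk g k' (ex k') (ey k') (ez k')
      (iterates W f epsk g x0 z0 ex ey ez k')
  else State 1%:M 0 z0 x0.

(* A noise process lists its arguments as time, agent, outcome. *)
Record noise (d : measure_display) (T : measurableType d) (R : realType)
    (P : probability T R) (n : nat) := Noise {
  noise_x : nat -> 'I_n -> {RV P >-> R};
  noise_y : nat -> 'I_n -> {RV P >-> n.-tuple R};
  noise_z : nat -> 'I_n -> {RV P >-> R} }.

Definition process (d : measure_display) (T : measurableType d) (R : realType)
    (P : probability T R) (n : nat) (W : 'M[R]_n) (f : 'I_n -> R -> R)
    (epsk : R) (g : gains R) (x0 z0 : 'cV[R]_n) (e : noise P n)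
    (k : nat) (w : T) : state R n :=
  iterates W f epsk g x0 z0
    (fun m => \col_i noise_x e m i w)
    (fun m => \matrix_(i, j) tnth (noise_y e m i w) j)
    (fun m => \col_i noise_z e m i w) k.

Definition mutually_independent (d : measure_display) (T : measurableType d)
    (R : realType) (P : probability T R) (I : eqType)
    (G : I -> set (set T)) : Prop :=
  forall (s : seq I) (A : I -> set T), uniq s ->
    (forall i, i \in s -> G i (A i)) ->
    P (\bigcap_(i in [set` s]) A i) = (\prod_(i <- s) P (A i))%E.

(* The sigma-algebras generated by all the noise variables, indexed by
   (time, agent) in a sum of three copies for e^x, e^y and e^z.  Each vector
   e^y_{i,k} is one member of the family: its components may be dependent. *)
Definition noise_sigma (d : measure_display) (T : measurableType d)
    (R : realType) (P : probability T R) (n : nat) (e : noise P n)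
    (u : (nat * 'I_n) + (nat * 'I_n) + (nat * 'I_n)) : set (set T) :=
  match u with
  | inl (inl (k, i)) => preimage_set_system setT (noise_x e k i) measurable
  | inl (inr (k, i)) => preimage_set_system setT (noise_y e k i) measurable
  | inr (k, i) => preimage_set_system setT (noise_z e k i) measurable
  end.

(* The variance of the vector e^y_{i,k} is E|e^y_{i,k} - E e^y_{i,k}|^2, the
   sum of the variances of its components. *)
Record noise_assumption (d : measure_display) (T : measurableType d)
    (R : realType) (P : probability T R) (n : nat) (sigma sigmay : R)
    (e : noise P n) : Prop := NoiseAssumption {
  noise_indep : mutually_independent P (noise_sigma e);
  noise_x_mean : forall k i, ('E_P[noise_x e k i] = 0)%E;
  noise_y_mean : forall k i j,
    ('E_P[fun w => tnth (noise_y e k i w) j] = 0)%E;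
  noise_z_mean : forall k i, ('E_P[noise_z e k i] = 0)%E;
  noise_x_var : forall k i, ('V_P[noise_x e k i] <= sigma%:E)%E;
  noise_y_var : forall k i,
    (\sum_(j < n) 'V_P[fun w => tnth (noise_y e k i w) j] <= sigma%:E)%E;
  noise_z_var : forall k i, ('V_P[noise_z e k i] <= sigma%:E)%E;
  noise_y_bounded : {ae P, forall w, forall k i,
    norm2 (\col_j tnth (noise_y e k i w) j) <= sigmay} }.

Definition wavg (R : realType) (n : nat) (r v : 'cV[R]_n) : R :=
  (r^T *m v) 0 0.

(* Big-O as k -> oo for extended-real sequences (expectations); the bound
   includes finiteness of [u k] for large k. *)
Definition is_bigO (R : realType) (u : nat -> \bar R) (v : nat -> R) : Prop :=
  exists C : R, \forall k \near \oo, (`|u k| <= (C * `|v k|)%:E)%E.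

(* Main.v *)
(** The gains are lambda_k = y^5, gamma_k = y^2, alpha_k = y^9 / (L + mu) and
    beta_k = y^7 with y = (k+1)^(-1/10); they give the rate y^4 = (k+1)^(-2/5)
    for all three quantities.

    The bound on e^y makes kappa deterministic up to O(y^3): the diagonal of the
    y-iterates grows like r_i y^(-8), while the accumulated noise and the
    consensus error are O(y^(-5)).  Hence kappa_(i,k) = 1 / (n r_i) + O(y^3).

    For x and z the noise is split off linearly.  Let N^x, N^z solve
    N' = W_k N + beta_k (I - 1 r^T) e, and let xi solve
    xi' = (1 - alpha_k mu) xi + beta_k r^T (e^x - e^z).  They are linear in the
    noise, so their second moments only need the noise variables to be pairwise
    uncorrelated; no filtration or conditional expectation appears.  The
    remainders Z = (I - 1 r^T) z - N^z, U = (I - 1 r^T) (x + z) - N^x and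
    u = r^T x - x^* - xi then satisfy pathwise contraction inequalities forced
    by N^x, N^z, xi and kappa.  A Lyapunov function u^2 + |U|^2 + K |Z|^2 shows
    first that they are bounded in mean square; feeding this bound back, the
    inequalities for Z, U and u, in this order, give the rate y^4. *)

Require Import Defs.
From HB Require Import structures.
From mathcomp Require Import all_boot all_order all_algebra.
From mathcomp Require Import all_classical all_reals all_analysis.
From mathcomp Require Import measurable_realfun.
From mathcomp Require Import ring lra.
Set Implicit Arguments.
Unset Strict Implicit.
Unset Printing Implicit Defensive.
Import Order.TTheory GRing.Theory Num.Theory.
Import numFieldNormedType.Exports.
Local Open Scope classical_set_scope.
Local Open Scope ring_scope.

(** * The time scale and Chung's lemma *)

(** The same gains serve every epsilon, because the rate 2/5 already beats 1/3. The orders come from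
    comparing forcing with contraction: [Z] has [alpha^2 / beta = y^11] against [y^7], which gives
    [y^4] and decides the rate; [xi] has [beta^2 = y^14] against [y^9], which gives [y^5]; [N^x] and
    [N^z] have [y^14] against [y^7]; the squared error of kappa is [y^6].

    The obstacle is that noise is a small input only as long as its cross terms vanish in mean,
    while gradients and kappa depend nonlinearly on it. Young's inequality applied to the raw noise
    would charge [beta^2 / alpha = y^5] per step against a contraction [y^9], and the bound would
    diverge. Hence the noise passes through linear filters, where the cross terms vanish exactly,
    and inequalities handle only the remainders.

    The choice [c_beta = 1] makes [W_0 = W], so the norm assumption at time 0 is a contraction of
    [W] itself; convexity passes it on to every lazy version of [W], including the one with
    [lambda_k] in the y-update. The choice [c_alpha = 1 / (L + mu)] makes the gradient step contract
    from the start. *)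

Definition decay (R : realType) (k : nat) : R := k.+1%:R `^ (- 10%:R^-1).

Section Decay.
Variable R : realType.
Local Notation y := (@decay R).

Lemma decay_gt0 k : 0 < y k.
Proof. by rewrite /decay powR_gt0. Qed.

Lemma decay_ge0 k : 0 <= y k.
Proof. exact: ltW (decay_gt0 k). Qed.

Lemma decay_powR m k : y k ^+ m = k.+1%:R `^ (- (m%:R / 10)).
Proof.
by rewrite /decay -powR_mulrn ?powR_ge0// -powRrM mulNr mulrC.
Qed.

Lemma decay_exp10 k : y k ^+ 10 = k.+1%:R^-1.
Proof. by rewrite decay_powR divff// powR_inv1. Qed.

Lemma decay_le1 k : y k <= 1.
Proof.
rewrite -(@ler_pXn2r _ 10) ?nnegrE ?decay_ge0// expr1n decay_exp10.
by rewrite invf_le1 ?ltr0n// ler1n.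
Qed.

Lemma decayX_le1 k m : y k ^+ m <= 1.
Proof. by rewrite exprn_ile1 ?decay_ge0 ?decay_le1. Qed.

Lemma decayX_ge0 k m : 0 <= y k ^+ m.
Proof. by rewrite exprn_ge0 ?decay_ge0. Qed.

Lemma decayX_gt0 k m : 0 < y k ^+ m.
Proof. by rewrite exprn_gt0 ?decay_gt0. Qed.

Lemma decayX_le k m m' : (m <= m')%N -> y k ^+ m' <= y k ^+ m.
Proof. by move=> h; rewrite ler_wiXn2l ?decay_ge0 ?decay_le1. Qed.

Lemma decayS_le k : y k.+1 <= y k.
Proof.
rewrite -(@ler_pXn2r _ 10) ?nnegrE ?decay_ge0// !decay_exp10.
by rewrite lef_pV2 ?posrE ?ltr0n// ler_nat.
Qed.

(** Taking tenth powers and using [(1 - t)^10 <= 1 - t] on [0, 1], this becomes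
    [(1 - 1/(k+1)) / (k+1) <= 1/(k+2)]. *)
Lemma decayS_ge k : y k * (1 - y k ^+ 10) <= y k.+1.
Proof.
have h1 : 0 <= 1 - y k ^+ 10 by rewrite subr_ge0 decayX_le1.
have h2 : 1 - y k ^+ 10 <= 1 by rewrite gerBl decayX_ge0.
rewrite -(@ler_pXn2r _ 10) ?nnegrE ?mulr_ge0 ?decay_ge0//.
rewrite exprMn; apply: (@le_trans _ _ (y k ^+ 10 * (1 - y k ^+ 10))).
  rewrite ler_wpM2l ?decayX_ge0//.
  by rewrite -[leRHS]expr1 ler_wiXn2l.
rewrite !decay_exp10 -[k.+2%:R]natr1 -natr1.
set a : R := k%:R; have a0 : 0 <= a by rewrite ler0n.
rewrite -[leRHS]mul1r ler_pdivlMr; last lra.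
rewrite -mulrA -subr_ge0.
have -> : 1 - (a + 1)^-1 * ((1 - (a + 1)^-1) * (a + 1 + 1)) = ((a + 1) ^-1) ^+ 2.
  by field; lra.
by rewrite sqr_ge0.
Qed.

(** Bernoulli's inequality: one step costs [y^t] at most the relative amount [t y^10], which is of
    smaller order than any contraction [y^s] with [s <= 9]. *)
Lemma decaySX_ge k t : y k ^+ t * (1 - t%:R * y k ^+ 10) <= y k.+1 ^+ t.
Proof.
elim: t => [|t IH]; first by rewrite !expr0 mul0r subr0 mulr1.
have h0 := decayX_ge0 k 10; have h1 := decayX_le1 k 10.
have [h|h] := lerP (1 - t%:R * y k ^+ 10) 0.
  apply: (@le_trans _ _ 0); last exact: decayX_ge0.
  rewrite mulr_ge0_le0 ?decayX_ge0// -natr1.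
  by rewrite mulrDl mul1r opprD addrA; apply: le_trans h; rewrite gerBl.
rewrite (exprS _ t) (exprS (y k.+1) t).
apply: (@le_trans _ _ ((y k * (1 - y k ^+ 10)) *
    (y k ^+ t * (1 - t%:R * y k ^+ 10)))); last first.
  apply: ler_pM IH; rewrite ?decayS_ge ?mulr_ge0 ?decay_ge0 ?decayX_ge0 ?subr_ge0//.
  by rewrite -subr_ge0 ltW.
rewrite mulrACA ler_wpM2l ?mulr_ge0 ?decayX_ge0 ?decay_ge0// -natr1.
rewrite -subr_ge0; set p := y k ^+ 10; set q := t%:R.
have -> : (1 - p) * (1 - q * p) - (1 - (q + 1) * p) = q * p ^+ 2 by ring.
by rewrite mulr_ge0 ?sqr_ge0// ler0n.
Qed.

Lemma decay_small (e : R) : 0 < e -> exists K, forall k, (K <= k)%N -> y k <= e.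
Proof.
move=> e0.
have [K HK] : exists K : nat, e ^- 10 <= K%:R.
  by exists (Num.truncn (e ^- 10)).+1; rewrite ltW// truncnS_gt.
have e0' := ltW e0.
exists K => k Kk; rewrite -(@ler_pXn2r _ 10) ?nnegrE ?decay_ge0//.
rewrite decay_exp10 -[leRHS]invrK lef_pV2 ?posrE ?ltr0n ?invr_gt0 ?exprn_gt0//.
by apply: (le_trans HK); rewrite ler_nat leqW.
Qed.

Lemma poly_gain_decay (c : R) m k : poly_gain c (m%:R / 10) k = c * y k ^+ m.
Proof. by rewrite /poly_gain decay_powR powRN. Qed.

Lemma finite_bound (v : nat -> R) t K :
  exists2 M, 0 <= M & forall k, (k <= K)%N -> v k <= M * y k ^+ t.
Proof.
elim: K => [|K [M M0 HM]].
  exists `|v 0%N / y 0%N ^+ t| => // k; rewrite leqn0 => /eqP ->.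
  by rewrite -ler_pdivrMr ?decayX_gt0// ler_norm.
exists (M + `|v K.+1 / y K.+1 ^+ t|) => [|k]; first by rewrite addr_ge0.
rewrite leq_eqVlt => /orP[/eqP ->|].
  by rewrite -ler_pdivrMr ?decayX_gt0// (le_trans (ler_norm _))// lerDr.
move=> /HM h; apply: (le_trans h).
by rewrite ler_wpM2r ?decayX_ge0// lerDl.
Qed.

(* Chung's lemma: a contraction factor 1 - c (k+1)^(-s/10) with s < 10 is
   stronger than the decrease of any power of k. *)
Lemma chung (v A : nat -> R) (c C : R) (s t K : nat) :
  0 < c -> (s <= 9)%N -> 0 <= C ->
  (forall k, 0 <= v k) -> (forall k, 0 <= A k) ->
  (forall k, (K <= k)%N -> A k <= 1 - c * y k ^+ s) ->
  (forall k, v k.+1 <= A k * v k + C * y k ^+ (s + t)) ->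
  exists2 M, 0 <= M & forall k, v k <= M * y k ^+ t.
Proof.
move=> c0 s9 C0 v0 A0 AK rec.
have [K1 HK1] : exists K1, forall k, (K1 <= k)%N -> t%:R * y k <= c / 2.
  have e0 : 0 < c / 2 / t.+1%:R by rewrite !divr_gt0.
  have [K1 H] := decay_small e0.
  exists K1 => k /H; rewrite ler_pdivlMr// mulrC; apply: le_trans.
  by rewrite ler_wpM2r ?decay_ge0// ler_nat.
pose K2 := maxn K K1.
have [M0 M00 HM0] := finite_bound v t K2.
(* The contraction [c y^s] is spent in two halves: one absorbs the loss [t y^10] of the power [y^t],
   the other absorbs the forcing, which requires [M c / 2 >= C]. The term [M0] covers the times
   before [K2]. *)
pose M := M0 + 2 * C / c.
have M_ge0 : 0 <= M by rewrite addr_ge0// divr_ge0 ?mulr_ge0// ltW.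
exists M => //; elim=> [|k IH].
  by apply: (le_trans (HM0 0%N _)); rewrite ?leq0n// ler_wpM2r ?decayX_ge0// lerDl
    divr_ge0 ?mulr_ge0// ltW.
have [kK|Kk] := ltnP k K2.
  by apply: (le_trans (HM0 _ kK)); rewrite ler_wpM2r ?decayX_ge0// lerDl
    divr_ge0 ?mulr_ge0// ltW.
have Kk' : (K <= k)%N by apply: leq_trans Kk; rewrite leq_maxl.
have K1k : (K1 <= k)%N by apply: leq_trans Kk; rewrite leq_maxr.
have h := AK _ Kk'.
have h' : 0 <= 1 - c * y k ^+ s := le_trans (A0 k) h.
apply: (le_trans (rec k)).
apply: (@le_trans _ _ ((1 - c * y k ^+ s) * (M * y k ^+ t) + C * y k ^+ (s + t))).
  rewrite lerD2r; apply: (le_trans (ler_wpM2r (v0 k) h)).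
  by rewrite ler_wpM2l.
apply: (@le_trans _ _ (M * (y k ^+ t * (1 - t%:R * y k ^+ 10)))); last first.
  by rewrite ler_wpM2l// decaySX_ge.
rewrite exprD -subr_ge0.
set Y := y k ^+ t; set S := y k ^+ s.
have -> : M * (Y * (1 - t%:R * y k ^+ 10)) - ((1 - c * S) * (M * Y) + C * (S * Y))
  = Y * (M * (c * S / 2 - t%:R * y k ^+ 10) + S * (M * c / 2 - C)) by field.
rewrite mulr_ge0 ?decayX_ge0// addr_ge0// mulr_ge0 ?decayX_ge0//.
  rewrite subr_ge0 (_ : y k ^+ 10 = y k ^+ 9 * y k); last by rewrite -exprSr.
  rewrite mulrCA; apply: (@le_trans _ _ (y k ^+ 9 * (c / 2))).
    by apply: ler_wpM2l; [exact: decayX_ge0 | exact: HK1].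
  rewrite (_ : c * S / 2 = S * (c / 2)); last by ring.
  apply: ler_wpM2r; last exact: decayX_le.
  by rewrite ltW// divr_gt0.
rewrite subr_ge0 ler_pdivlMr// /M mulrDl divfK ?gt_eqF// [C * 2]mulrC.
by rewrite lerDr mulr_ge0// ltW.
Qed.

End Decay.

(** * Quadratic forms and averaging matrices *)

(** Expanding the nonnegative double sum of [(x i - x j)^2] gives twice the difference of the two
    sides. *)
Lemma sqr_sum_le (R : realType) (I : finType) (x : I -> R) :
  (\sum_i x i) ^+ 2 <= #|I|%:R * \sum_i x i ^+ 2.
Proof.
have : 0 <= \sum_i \sum_j (x i - x j) ^+ 2.
  by apply: sumr_ge0 => i _; apply: sumr_ge0 => j _; exact: sqr_ge0.
set S := \sum_i x i; set Q := \sum_i x i ^+ 2.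
have inner i : \sum_j (x i - x j) ^+ 2 = #|I|%:R * x i ^+ 2 + (- (2 * S)) * x i + Q.
  transitivity (\sum_j (x i ^+ 2 + (- (2 * x i)) * x j + x j ^+ 2)).
    by apply: eq_bigr => j _; ring.
  by rewrite !big_split/= sumr_const -mulr_sumr -[_ *+ #|_|]mulr_natl -/S -/Q; ring.
under eq_bigr do rewrite inner.
rewrite !big_split/= sumr_const -!mulr_sumr -[_ *+ #|_|]mulr_natl -/S -/Q; lra.
Qed.

(** The square of [normA A v], which avoids square roots. Rectangular [A] is allowed because forms
    such as [B *m r^T] occur for the scalar filter. *)
Definition qf (R : realType) (m n : nat) (A : 'M[R]_(m, n)) (v : 'cV[R]_n) : R :=
  \sum_i (A *m v) i 0 ^+ 2.

Section QuadraticForm.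
Variables (R : realType) (m n : nat) (A : 'M[R]_(m, n)).
Implicit Types u v : 'cV[R]_n.

Lemma qf_ge0 v : 0 <= qf A v.
Proof. by apply: sumr_ge0 => i _; exact: sqr_ge0. Qed.

Lemma qf0 : qf A 0 = 0.
Proof. by rewrite /qf mulmx0 big1// => i _; rewrite mxE expr0n. Qed.

Lemma qfZ a v : qf A (a *: v) = a ^+ 2 * qf A v.
Proof.
by rewrite /qf mulr_sumr; apply: eq_bigr => i _; rewrite -scalemxAr mxE exprMn.
Qed.

Lemma qfN v : qf A (- v) = qf A v.
Proof. by rewrite -scaleN1r qfZ sqrrN expr1n mul1r. Qed.

Lemma mulmx_addE u v i : (A *m (u + v)) i 0 = (A *m u) i 0 + (A *m v) i 0.
Proof. by rewrite mulmxDr mxE. Qed.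

Lemma mulmx_scaleE a v i : (A *m (a *: v)) i 0 = a * (A *m v) i 0.
Proof. by rewrite -scalemxAr mxE. Qed.

(** Young's inequality with a free weight [h]; the weight is later tuned to the contraction that is
    available. *)
Lemma qfD (h : R) u v : 0 < h -> qf A (u + v) <= (1 + h) * qf A u + (1 + h^-1) * qf A v.
Proof.
move=> h0; rewrite /qf !mulr_sumr -big_split; apply: ler_sum => i _ /=.
rewrite mulmx_addE; set a := (_ *m u) i 0; set b := (_ *m v) i 0.
rewrite -subr_ge0.
have -> : (1 + h) * a ^+ 2 + (1 + h^-1) * b ^+ 2 - (a + b) ^+ 2
    = (h * a - b) ^+ 2 / h by field; exact: lt0r_neq0.
by rewrite divr_ge0 ?sqr_ge0 ?(ltW h0).
Qed.

Lemma qfD2 u v : qf A (u + v) <= 2 * (qf A u + qf A v).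
Proof. by rewrite mulrDr; have := qfD u v ltr01; rewrite invr1. Qed.

Lemma qf_convex t u v : 0 <= t <= 1 ->
  qf A ((1 - t) *: u + t *: v) <= (1 - t) * qf A u + t * qf A v.
Proof.
move=> /andP[t0 t1]; rewrite /qf !mulr_sumr -big_split; apply: ler_sum => i _ /=.
rewrite mulmx_addE !mulmx_scaleE.
set a := (_ *m u) i 0; set b := (_ *m v) i 0.
rewrite -subr_ge0.
have -> : (1 - t) * a ^+ 2 + t * b ^+ 2 - ((1 - t) * a + t * b) ^+ 2
    = t * (1 - t) * (a - b) ^+ 2 by ring.
apply: mulr_ge0; last exact: sqr_ge0.
by rewrite mulr_ge0// subr_ge0.
Qed.

Lemma qf_bound : exists2 C, 0 <= C & forall v, qf A v <= C * \sum_i v i 0 ^+ 2.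
Proof.
exists (n%:R * \sum_i \sum_j A i j ^+ 2) => [|v].
  by rewrite mulr_ge0// sumr_ge0// => i _; rewrite sumr_ge0// => j _; rewrite sqr_ge0.
rewrite /qf -mulrA mulr_suml mulr_sumr; apply: ler_sum => i _; rewrite mxE.
apply: (le_trans (sqr_sum_le _)); rewrite card_ord ler_wpM2l//.
rewrite mulr_suml; apply: ler_sum => j _; rewrite exprMn ler_wpM2l ?sqr_ge0//.
by rewrite (bigD1 j)//= lerDl sumr_ge0// => k _; rewrite sqr_ge0.
Qed.

End QuadraticForm.

Section Norms.
Variables (R : realType) (n : nat).
Implicit Types (A M : 'M[R]_n) (v : 'cV[R]_n).

Lemma norm2_sqr v : norm2 v ^+ 2 = \sum_i v i 0 ^+ 2.
Proof. by rewrite sqr_sqrtr// sumr_ge0// => i _; rewrite sqr_ge0. Qed.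

Lemma norm2_ge0 v : 0 <= norm2 v. Proof. exact: sqrtr_ge0. Qed.

Lemma normA_sqr A v : normA A v ^+ 2 = qf A v.
Proof. exact: norm2_sqr. Qed.

Lemma norm2Z a v : 0 <= a -> norm2 (a *: v) = a * norm2 v.
Proof.
move=> a0; rewrite /norm2 -[in RHS](sqr_sqrtr a0) expr2.
under eq_bigr do rewrite mxE exprMn.
rewrite -mulr_sumr sqrtrM ?sqr_ge0// sqrtr_sqr ger0_norm// -expr2 sqr_sqrtr//.
Qed.

Lemma norm2_mulmx_bounded M :
  exists2 C, 0 <= C & forall v, norm2 (M *m v) <= C * norm2 v.
Proof.
have [C C0 HC] := qf_bound M; exists (Num.sqrt C) => [|v]; first exact: sqrtr_ge0.
rewrite -(@ler_pXn2r _ 2) ?nnegrE ?mulr_ge0 ?norm2_ge0 ?sqrtr_ge0//.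
by rewrite exprMn (sqr_sqrtr C0) !norm2_sqr; exact: HC.
Qed.

Lemma norm2_eq0 v : norm2 v = 0 -> v = 0.
Proof.
move=> v0; have /eqP := norm2_sqr v; rewrite v0 expr0n /= eq_sym psumr_eq0; last first.
  by move=> i _; rewrite sqr_ge0.
move=> /allP h; apply/matrixP => i j; rewrite ord1 mxE.
by have := h i (mem_index_enum _); rewrite sqrf_eq0 => /eqP.
Qed.

(** [opnorm2] is a real [sup], so it bounds its set only once that set is known to be nonempty and
    bounded. *)
Lemma opnorm2_has_sup M :
  has_sup [set norm2 (M *m v) | v in [set v : 'cV[R]_n | norm2 v <= 1]].
Proof.
have norm20 : norm2 (0 : 'cV[R]_n) = 0.
  by rewrite /norm2 big1 ?sqrtr0// => i _; rewrite mxE expr0n.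
split; first by exists (norm2 (M *m 0)); exists 0 => //=; rewrite norm20.
have [C C0 HC] := norm2_mulmx_bounded M.
exists C => _ [v /= v1 <-]; apply: (le_trans (HC v)).
by rewrite -[leRHS]mulr1 ler_wpM2l.
Qed.

Lemma opnorm2_ge0 M : 0 <= opnorm2 M.
Proof.
have [[_ [v v1 _]] ub] := opnorm2_has_sup M.
apply: (le_trans (norm2_ge0 (M *m v))); apply: ub_le_sup => //; by exists v.
Qed.

Lemma norm2_mulmx_le M v : norm2 (M *m v) <= opnorm2 M * norm2 v.
Proof.
have [v0|v0] := eqVneq (norm2 v) 0.
  by rewrite v0 mulr0 (norm2_eq0 v0) mulmx0 le_eqVlt /norm2 big1 ?sqrtr0 ?eqxx// => i _;
    rewrite mxE expr0n.
have vgt : 0 < norm2 v by rewrite lt0r v0 norm2_ge0.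
rewrite -ler_pdivrMr// mulrC -norm2Z ?invr_ge0 ?norm2_ge0// scalemxAr.
apply: ub_le_sup; first by have [] := opnorm2_has_sup M.
exists ((norm2 v)^-1 *: v) => //=.
by rewrite norm2Z ?invr_ge0 ?norm2_ge0// mulVf.
Qed.

End Norms.

(** * Contraction of averaging matrices on the disagreement subspace *)

Section Averaging.
Variables (R : realType) (n : nat) (W : 'M[R]_n) (r : 'cV[R]_n).
Hypotheses (W1 : W *m ones R n = ones R n) (rW : r^T *m W = r^T)
  (r1 : \sum_i r i 0 = 1).
Implicit Types (v w x : 'cV[R]_n).

(* [Wk W g k] is [lazy (beta g k)]; the matrix of the y-update is [lazy (lambda g k)]. *)
Definition lazy (t : R) : 'M[R]_n := (1 - t)%:M + t *: W.

(* The projection onto the disagreement subspace, I - 1 r^T. *)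
Definition dev : 'M[R]_n := 1%:M - ones R n *m r^T.

Lemma dev_wavg x : x - wavg r x *: ones R n = dev *m x.
Proof.
rewrite /dev mulmxBl mul1mx -mulmxA; congr (_ - _).
rewrite [r^T *m x]mx11_scalar; apply/matrixP => i j.
by rewrite mul_mx_scalar.
Qed.

Lemma wavg_ones : r^T *m ones R n = 1%:M.
Proof.
apply/matrixP => i j; rewrite !ord1 !mxE -[in RHS]r1.
by apply: eq_bigr => k _; rewrite !mxE mulr1.
Qed.

Lemma trmx_dev : r^T *m dev = 0.
Proof. by rewrite mulmxBr mulmx1 mulmxA wavg_ones mul1mx subrr. Qed.

Lemma lazyE t v : lazy t *m v = (1 - t) *: v + t *: (W *m v).
Proof. by rewrite mulmxDl mul_scalar_mx -scalemxAl. Qed.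

Lemma lazy_dev t x : lazy t *m (dev *m x) = dev *m (lazy t *m x).
(* [W] fixes [ones] on the right and [r] on the left, hence commutes with the projection. *)
Proof.
have WD : W *m dev = dev *m W.
  by rewrite mulmxBr mulmxBl mulmx1 mul1mx mulmxA W1 -mulmxA rW.
by rewrite !lazyE mulmxDr -!scalemxAr !mulmxA WD.
Qed.

Lemma trmx_lazy t x : r^T *m (lazy t *m x) = r^T *m x.
Proof.
by rewrite lazyE mulmxDr -!scalemxAr mulmxA rW -scalerDl subrK scale1r.
Qed.

Variables (A : 'M[R]_n) (rho : R).
Hypothesis rho_gt0 : 0 < rho.
Hypothesis contr : forall v, qf A ((W - ones R n *m r^T) *m v) <= (1 - rho) * qf A v.

(** Where [r^T v = 0], [W] acts as [W - 1 r^T]. Since [lazy t] is a convex combination of the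
    identity and [W], convexity of the square turns the rate [rho] at [t = 1] into [t rho]. *)
Lemma qf_lazy t v : 0 <= t <= 1 -> r^T *m v = 0 ->
  qf A (lazy t *m v) <= (1 - t * rho) * qf A v.
Proof.
move=> t01 rv; rewrite lazyE.
have -> : W *m v = (W - ones R n *m r^T) *m v.
  by rewrite mulmxBl -mulmxA rv mulmx0 subr0.
apply: (le_trans (qf_convex _ _ _ t01)).
move/andP: t01 => [t0 t1].
rewrite (_ : (1 - t * rho) * _ = (1 - t) * qf A v + t * ((1 - rho) * qf A v)); last by ring.
by rewrite lerD2l ler_wpM2l.
Qed.

(** Young's inequality with weight [t rho / 2] gives up half of the contraction. The input carries
    [t^2], so its cost [1 / t] still leaves a factor [t]. *)
Lemma qf_lazy_step t v w : 0 < t <= 1 -> r^T *m v = 0 ->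
  qf A (lazy t *m v + t *: w) <=
    (1 - t * rho / 2) * qf A v + t * (1 + 2 / rho) * qf A w.
Proof.
move=> /andP[t0 t1] rv.
have th : 0 < t * rho / 2 by rewrite divr_gt0// mulr_gt0.
apply: (le_trans (qfD _ _ _ th)); rewrite qfZ mulrA; apply: lerD.
  apply: (@le_trans _ _ ((1 + t * rho / 2) * ((1 - t * rho) * qf A v))).
    by apply: ler_wpM2l; [rewrite addr_ge0 ?(ltW th)|apply: qf_lazy; rewrite ?(ltW t0)].
  rewrite mulrA ler_wpM2r ?qf_ge0//.
  have : 0 <= (t * rho) ^+ 2 by rewrite sqr_ge0.
  set p := t * rho => hp; rewrite -subr_ge0.
  by have -> : 1 - p / 2 - (1 + p / 2) * (1 - p) = p ^+ 2 / 2; [field|lra].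
rewrite ler_wpM2r ?qf_ge0// -subr_ge0.
have -> : t * (1 + 2 / rho) - (1 + (t * rho / 2)^-1) * t ^+ 2 = t * (1 - t).
  by field; rewrite !gt_eqF.
by rewrite mulr_ge0 ?subr_ge0 ?(ltW t0).
Qed.

End Averaging.

(** With [beta g 0 = 1], the assumption at time 0 concerns [W - 1 r^T]. An operator norm is
    nonnegative, so [rho <= 1], and then [(1 - rho)^2 <= 1 - rho]. *)
Lemma contractive_norm_qf (R : realType) (n : nat) (W : 'M[R]_n) (r : 'cV[R]_n)
    (g : gains R) (A : 'M[R]_n) (rho : R) :
  beta g 0 = 1 -> contractive_norm W r g A rho ->
  [/\ 0 < rho, rho <= 1,
      forall v, qf A ((W - ones R n *m r^T) *m v) <= (1 - rho) * qf A v &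
      forall v : 'cV[R]_n, \sum_i v i 0 ^+ 2 <= qf A v].
Proof.
move=> b1 [uA rho0 bnd sc].
have /andP[h _] := bnd 0%N; move: h.
rewrite b1 mul1r /Wk b1 subrr -scalemx1 scale0r add0r scale1r => h.
have rho1 : 0 <= 1 - rho by apply: le_trans h; exact: opnorm2_ge0.
split=> //; first by rewrite -subr_ge0.
  move=> v; rewrite -!normA_sqr.
  apply: (@le_trans _ _ (((1 - rho) * normA A v) ^+ 2)).
    rewrite ler_pXn2r ?nnegrE ?mulr_ge0 ?norm2_ge0//.
    apply: le_trans (ler_wpM2r (norm2_ge0 _) h).
    rewrite /opnormA; apply: le_trans (norm2_mulmx_le _ _).
    by rewrite /normA !mulmxA mulmxKV// -!mulmxA.
  rewrite exprMn ler_wpM2r ?sqr_ge0// expr2 -[leRHS]mulr1 ler_wpM2l// gerBl.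
  exact: ltW.
move=> v; rewrite -norm2_sqr -normA_sqr ler_pXn2r ?nnegrE ?norm2_ge0//.
Qed.

(** * Gradient steps *)

Section Smooth.
Variables (R : realType) (f : R -> R) (mu L : R).
Hypotheses (mu0 : 0 < mu) (L0 : 0 < L).
Hypotheses (hc : strongly_convex mu f) (hs : smooth L f).

Lemma smooth_mvt (a b : R) :
  exists2 c, `|c - a| <= `|b - a| & f b - f a = derive1 f c * (b - a).
Proof.
have [df _] := hs.
have isd (x : R) : is_derive x (1 : R) f (derive1 f x).
  by rewrite derive1E; apply: DeriveDef.
have cont (u v : R) : {within `[u, v], continuous f}.
  apply: continuous_subspaceT => x.
  by apply: differentiable_continuous; apply/derivable1_diffP.
have [ab|ba] := lerP a b.
  have [c] := MVT_segment ab (fun x _ => isd x) (@cont a b).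
  rewrite in_itv /= => /andP[ac cb] h; exists c => //.
  by rewrite !ger0_norm ?subr_ge0// lerD2r.
have [c] := MVT_segment (ltW ba) (fun x _ => isd x) (@cont b a).
rewrite in_itv /= => /andP[bc ca] h; exists c.
  by rewrite distrC ger0_norm ?subr_ge0// lerD2l lerN2.
by rewrite -opprB h -mulrN opprB.
Qed.

(** The mean value theorem gives the constant [L] instead of the sharp [L / 2]; constants do not
    affect the rates. *)
Lemma smooth_taylor (y h : R) :
  `|f (y + h) - f y - derive1 f y * h| <= L * h ^+ 2.
Proof.
have [c hc' ->] := smooth_mvt y (y + h).
rewrite addrAC subrr add0r in hc' *.
rewrite -mulrBl normrM -(real_normK (num_real h)) expr2 mulrA ler_wpM2r//.
apply: (le_trans (hs.2 _ _)); rewrite ler_wpM2l ?(ltW L0)//.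
Qed.

(** Stands for the limit [t -> 0]: if [E] were positive, [t = E / (E + K)] would give
    [E + K <= K]. *)
Lemma le0_of_small (E K : R) : 0 <= K -> (forall t, 0 < t <= 1 -> E <= t * K) -> E <= 0.
Proof.
move=> K0 h; rewrite leNgt; apply/negP => E0.
have EK : 0 < E + K by rewrite ltr_wpDr.
have t01 : 0 < E / (E + K) <= 1.
  by rewrite divr_gt0//= ler_pdivrMr// mul1r lerDl.
have := h _ t01; rewrite mulrAC ler_pdivlMr//.
by rewrite ler_pM2l// leNgt -subr_gt0 addrK E0.
Qed.

(** Strong convexity at [y + t (x - y)] together with the Taylor bound at [y], divided by [t],
    leaves an error proportional to [t]. *)
Lemma strongly_convex_tangent (x y : R) :
  derive1 f y * (x - y) <= f x - f y - mu / 2 * (x - y) ^+ 2.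
Proof.
rewrite -subr_le0; apply: (@le0_of_small _ ((L + mu / 2) * (x - y) ^+ 2)).
  by rewrite mulr_ge0 ?sqr_ge0// addr_ge0 ?(ltW L0)// divr_ge0// ltW.
move=> t /andP[t0 t1].
have := hc x y (t := t); rewrite (ltW t0) t1 => /(_ isT).
have -> : t * x + (1 - t) * y = y + t * (x - y) by ring.
have := smooth_taylor y (t * (x - y)).
rewrite ler_norml => /andP[lo _] up.
have : t * (derive1 f y * (x - y) - (f x - f y - mu / 2 * (x - y) ^+ 2)) <=
    t * (t * ((L + mu / 2) * (x - y) ^+ 2)).
  rewrite -subr_ge0; rewrite -subr_ge0 in lo; rewrite -subr_ge0 in up.
  apply: (le_trans (addr_ge0 lo up)).
  by rewrite le_eqVlt; apply/orP; left; apply/eqP; field.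
by rewrite ler_pM2l.
Qed.

Lemma strongly_monotone (x y : R) :
  mu * (x - y) ^+ 2 <= (derive1 f x - derive1 f y) * (x - y).
Proof.
have := strongly_convex_tangent x y; have := strongly_convex_tangent y x.
set a := derive1 f x; set b := derive1 f y; set fx := f x; set fy := f y => h1 h2.
have e : (y - x) ^+ 2 = (x - y) ^+ 2 by ring.
rewrite e in h1; nra.
Qed.

End Smooth.

(** * The averaged objective and its exact gradient step *)

Section Average.
Variables (R : realType) (n : nat) (f : 'I_n -> R -> R) (mu L xs : R).
Hypotheses (n0 : (0 < n)%N) (mu0 : 0 < mu) (L0 : 0 < L).
Hypotheses (hc : forall i, strongly_convex mu (f i)) (hs : forall i, smooth L (f i)).
Hypothesis hxs : minimizer (average f) xs.

Definition avg_grad x := n%:R^-1 * \sum_i derive1 (f i) x.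

Lemma avg_const (c : R) : n%:R^-1 * \sum_(i < n) c = c.
Proof.
by rewrite sumr_const card_ord -[c *+ n]mulr_natl mulKf// pnatr_eq0 -lt0n.
Qed.

Lemma avg_le (u v : 'I_n -> R) : (forall i, u i <= v i) ->
  n%:R^-1 * \sum_i u i <= n%:R^-1 * \sum_i v i.
Proof. by move=> h; rewrite ler_wpM2l ?invr_ge0// ler_sum. Qed.

Lemma avg_taylor y h :
  average f (y + h) - average f y <= avg_grad y * h + L * h ^+ 2.
Proof.
rewrite /average /avg_grad -(avg_const (L * h ^+ 2)) -mulrBr -mulrA -mulrDr.
rewrite -sumrB mulr_suml -big_split; apply: avg_le => i /=.
have := smooth_taylor L0 (hs i) y h.
by rewrite ler_norml => /andP[_]; rewrite lerBlDl.
Qed.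

Lemma avg_grad_min : avg_grad xs = 0.
Proof.
apply/eqP/negPn/negP => d0; set d := avg_grad xs in d0.
(* This step minimizes the upper bound [d h + L h^2]; its value [- d^2 / (4 L)] would contradict
   minimality of [xs]. *)
have := avg_taylor xs (- (d / (2 * L))); rewrite -/d.
have : 0 <= average f (xs + - (d / (2 * L))) - average f xs.
  by rewrite subr_ge0; exact: hxs.
move=> h1 h2; have := le_trans h1 h2.
have -> : d * - (d / (2 * L)) + L * (- (d / (2 * L))) ^+ 2 = - (d ^+ 2 / (4 * L)).
  by field; exact: lt0r_neq0.
have d2 : 0 < d ^+ 2 by rewrite lt0r sqrf_eq0 d0 sqr_ge0.
by rewrite oppr_ge0 leNgt (divr_gt0 d2)// mulr_gt0.
Qed.

Lemma avg_gap x : average f x - average f xs <= L * (x - xs) ^+ 2.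
Proof.
have := avg_taylor xs (x - xs).
by rewrite avg_grad_min mul0r add0r [xs + _]addrC subrK.
Qed.

Lemma avg_grad_lip x y : `|avg_grad x - avg_grad y| <= L * `|x - y|.
Proof.
rewrite /avg_grad -mulrBr -sumrB normrM ger0_norm ?invr_ge0//.
rewrite -[leRHS]avg_const; apply: (le_trans (ler_wpM2l _ (ler_norm_sum _ _ _))).
  by rewrite invr_ge0.
by apply: avg_le => i; exact: (hs i).2.
Qed.

Lemma avg_grad_mono x y : mu * (x - y) ^+ 2 <= (avg_grad x - avg_grad y) * (x - y).
Proof.
rewrite /avg_grad -mulrBr -sumrB -mulrA mulr_suml -[leLHS]avg_const.
by apply: avg_le => i; exact: (strongly_monotone mu0 L0 (hc i) (hs i)).
Qed.

(** In one dimension the gradient [G] lies between [mu u] and [L u], which is [key]. It bounds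
    [G^2], after which the claim reduces to [a (2 - a (L + mu)) (G u - mu u^2) >= 0]. *)
Lemma grad_step (a u : R) : 0 <= a -> a * (L + mu) <= 1 ->
  (u - a * avg_grad (xs + u)) ^+ 2 <= (1 - a * mu) ^+ 2 * u ^+ 2.
Proof.
move=> a0 aL.
have := avg_grad_mono (xs + u) xs; have := avg_grad_lip (xs + u) xs.
rewrite avg_grad_min subr0 addrAC subrr add0r; set G := avg_grad _ => lip mono.
have aL' : a * L <= 1.
  by apply: le_trans aL; rewrite ler_wpM2l// lerDl ltW.
have am' : a * mu <= 1.
  by apply: le_trans aL; rewrite ler_wpM2l// lerDr ltW.
have key : 0 <= (G - mu * u) * (L * u - G).
  have [u0|u0|u0] := ltgtP u 0.
  - rewrite (ltr0_norm u0) ler_norml in lip; move/andP: lip => [l1 l2].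
    apply: mulr_le0; nra.
  - rewrite (gtr0_norm u0) ler_norml in lip; move/andP: lip => [l1 l2].
    apply: mulr_ge0; nra.
  - move: lip; rewrite u0 normr0 mulr0 normr_le0 => /eqP ->.
    by rewrite !mulr0 !subr0 mul0r.
have G2 : G ^+ 2 <= (L + mu) * (G * u) - L * mu * u ^+ 2 by nra.
have h1 : a ^+ 2 * G ^+ 2 <= a ^+ 2 * ((L + mu) * (G * u) - L * mu * u ^+ 2).
  by rewrite ler_wpM2l// sqr_ge0.
have h2 : 0 <= a * (2 - a * (L + mu)) * (G * u - mu * u ^+ 2).
  by rewrite mulr_ge0 ?subr_ge0// ?mulr_ge0 ?subr_ge0//; lra.
by rewrite -subr_ge0; nra.
Qed.

End Average.

(** Convexity of the square with weights [1 - m] and [m], where [m = a mu]: the sum squared is at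
    most [p^2 / (1 - m) + (a E)^2 / m]. One of the two factors [1 - m] in the hypothesis
    survives. *)
Lemma perturbed_step (R : realType) (p u E a mu : R) :
  0 < a -> 0 < mu -> a * mu < 1 -> p ^+ 2 <= (1 - a * mu) ^+ 2 * u ^+ 2 ->
  (p + a * E) ^+ 2 <= (1 - a * mu) * u ^+ 2 + a / mu * E ^+ 2.
Proof.
move=> a0 mu0 am hp; set m := a * mu in am hp *.
have m0 : 0 < m by rewrite mulr_gt0.
have m1 : 0 < 1 - m by rewrite subr_gt0.
apply: (@le_trans _ _ (p ^+ 2 / (1 - m) + a / mu * E ^+ 2)); last first.
  by rewrite lerD2r ler_pdivrMr// mulrAC -expr2.
rewrite -subr_ge0.
have -> : p ^+ 2 / (1 - m) + a / mu * E ^+ 2 - (p + a * E) ^+ 2 =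
  (m * p - (1 - m) * (a * E)) ^+ 2 / (m * (1 - m)).
  by rewrite /m; field; rewrite (gt_eqF m1) !gt_eqF.
by rewrite divr_ge0 ?sqr_ge0// mulr_ge0// ltW.
Qed.

(** * Processes dominated in mean *)

(** The integral of a nonnegative function is a supremum over simple functions below it, so it is
    monotone even off the measurable functions. *)
Lemma ge0_le_integral_nonmeasurable d (T : measurableType d) (R : realType)
    (mu : {measure set T -> \bar R}) (f g : T -> \bar R) :
  (forall x, (0 <= f x)%E) -> (forall x, (f x <= g x)%E) ->
  (\int[mu]_x f x <= \int[mu]_x g x)%E.
Proof.
move=> f0 fg; have g0 x : (0 <= g x)%E by exact: le_trans (fg x).
rewrite !ge0_integralTE//; apply: le_ereal_sup => _ [h hf <-].
by exists h => // x; exact: le_trans (fg x).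
Qed.

Section Dominated.
Context d (T : measurableType d) (R : realType) (P : probability T R).
Variable Om : set T.
Local Notation y := (@decay R).

(* The iterates need not be shown measurable: it suffices to dominate them by
   measurable processes. *)
Definition dominated (V : nat -> T -> R) (t : nat) : Prop :=
  exists h : nat -> T -> R,
  [/\ forall k, measurable_fun setT (h k), forall k w, 0 <= h k w,
      forall k w, Om w -> V k w <= h k w &
      exists2 C, 0 <= C & forall k, (\int[P]_w (h k w)%:E <= (C * y k ^+ t)%:E)%E].

Lemma integral_affine (a : R) (h1 h2 : T -> R) : 0 <= a ->
  measurable_fun setT h1 -> measurable_fun setT h2 ->
  (forall w, 0 <= h1 w) -> (forall w, 0 <= h2 w) ->
  (\int[P]_w (a * h1 w + h2 w)%:E =
    a%:E * \int[P]_w (h1 w)%:E + \int[P]_w (h2 w)%:E)%E.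
Proof.
move=> a0 m1 m2 h10 h20.
under eq_integral do rewrite EFinD EFinM.
rewrite ge0_integralD//=.
- by rewrite ge0_integralZl//=; [exact/measurable_EFinP | move=> w _; rewrite lee_fin].
- by move=> w _; rewrite -EFinM lee_fin mulr_ge0.
- by apply/measurable_EFinP; exact: measurable_funM.
- by move=> w _; rewrite lee_fin.
- exact/measurable_EFinP.
Qed.

Lemma integral_scale (a : R) (h : T -> R) : 0 <= a ->
  measurable_fun setT h -> (forall w, 0 <= h w) ->
  (\int[P]_w (a * h w)%:E = a%:E * \int[P]_w (h w)%:E)%E.
Proof.
move=> a0 mh h0; under eq_integral do rewrite EFinM.
by rewrite ge0_integralZl//=; [exact/measurable_EFinP | move=> w _; rewrite lee_fin].
Qed.

Lemma dominated_le V V' t : (forall k w, Om w -> V k w <= V' k w) ->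
  dominated V' t -> dominated V t.
Proof.
move=> VV' [h [m h0 hV hC]]; exists h; split=> // k w Ow.
exact: le_trans (VV' _ _ Ow) (hV _ _ Ow).
Qed.

Lemma dominated_affine (a : R) V V' t : 0 <= a ->
  dominated V t -> dominated V' t -> dominated (fun k w => a * V k w + V' k w) t.
Proof.
move=> a0 [h [m h0 hV [C C0 hC]]] [h' [m' h0' hV' [C' C0' hC']]].
exists (fun k w => a * h k w + h' k w); split=> [k|k w|k w Ow|].
- by apply: measurable_funD => //; exact: measurable_funM.
- by rewrite addr_ge0// mulr_ge0.
- by rewrite lerD ?hV'// ler_wpM2l// hV.
exists (a * C + C') => [|k]; first by rewrite addr_ge0// mulr_ge0.
rewrite integral_affine// mulrDl EFinD; apply: leeD; last exact: hC'.
by rewrite -mulrA [leRHS]EFinM; apply: lee_wpmul2l; rewrite ?lee_fin.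
Qed.

Lemma dominated_decay (c : R) t : 0 <= c -> dominated (fun k _ => c * y k ^+ t) t.
Proof.
move=> c0; exists (fun k _ => c * y k ^+ t); split=> // [k w|].
  by rewrite mulr_ge0 ?decayX_ge0.
by exists c => // k; rewrite integral_cst//= probability_setT mule1.
Qed.

Lemma dominated_scale (c : R) V t : 0 <= c ->
  dominated V t -> dominated (fun k w => c * V k w) t.
Proof.
move=> c0 V0; apply: (dominated_le _ (dominated_affine c0 V0 (dominated_decay t (lexx 0)))).
by move=> k w _; rewrite mul0r addr0.
Qed.

Lemma dominated_add V V' t : dominated V t -> dominated V' t ->
  dominated (fun k w => V k w + V' k w) t.
Proof.
move=> h h'; apply: (dominated_le _ (dominated_affine ler01 h h')) => k w _.
by rewrite mul1r.
Qed.

Lemma dominated_weaken V t t' : (t' <= t)%N -> dominated V t -> dominated V t'.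
Proof.
move=> tt' [h [m h0 hV [C C0 hC]]]; exists h; split=> //.
exists C => // k; apply: (le_trans (hC k)).
by rewrite lee_fin ler_wpM2l// decayX_le.
Qed.

Lemma dominated_decayM (c : R) V t s : 0 <= c -> dominated V t ->
  dominated (fun k w => c * y k ^+ s * V k w) (s + t).
Proof.
move=> c0 [h [m h0 hV [C C0 hC]]].
have cy k : 0 <= c * y k ^+ s by rewrite mulr_ge0 ?decayX_ge0.
exists (fun k w => c * y k ^+ s * h k w); split=> [k|k w|k w Ow|].
- exact: measurable_funM.
- by rewrite mulr_ge0.
- by rewrite ler_wpM2l// hV.
exists (c * C) => [|k]; first by rewrite mulr_ge0.
rewrite integral_scale// exprD mulrACA [leRHS]EFinM.
by apply: lee_wpmul2l => //; rewrite lee_fin.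
Qed.

(** Solving the recursion with equality, driven by the dominating process of [F], gives a measurable
    [h] above [V]. Its mean obeys the deterministic recursion [v], to which [chung] applies. *)
Lemma dominated_chung (V F : nat -> T -> R) (A : nat -> R) (c v0 : R) (s t K : nat) :
  0 < c -> (s <= 9)%N -> (forall k, 0 <= A k) ->
  (forall k, (K <= k)%N -> A k <= 1 - c * y k ^+ s) ->
  dominated F (s + t) ->
  (forall w, Om w -> V 0%N w <= v0) ->
  (forall k w, Om w -> V k.+1 w <= A k * V k w + F k w) ->
  dominated V t.
Proof.
move=> c0 s9 A0 AK [hF [m h0 hV [C C0 hC]]] V0 rec.
pose h := fix h k w := if k is k'.+1 then A k' * h k' w + hF k' w else `|v0|.
pose v := fix v k := if k is k'.+1 then A k' * v k' + C * y k' ^+ (s + t) else `|v0|.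
have v_ge0 k : 0 <= v k.
  by elim: k => //= k IH; rewrite addr_ge0 ?mulr_ge0 ?decayX_ge0.
have h_ge0 k w : 0 <= h k w.
  by elim: k => //= k IH; rewrite addr_ge0 ?mulr_ge0.
have mh k : measurable_fun setT (h k).
  elim: k => [|k IH]; first exact: measurable_cst.
  by apply: measurable_funD => //; exact: measurable_funM.
have [M M0 HM] := chung c0 s9 C0 v_ge0 A0 AK (fun k => lexx (v k.+1)).
exists h; split=> // [k w Ow|].
  elim: k => [|k IH] /=; first by apply: le_trans (V0 w Ow) (ler_norm _).
  by apply: (le_trans (rec k w Ow)); rewrite lerD ?hV// ler_wpM2l.
exists M => // k; apply: (@le_trans _ _ (v k)%:E); last by rewrite lee_fin.
elim: k => [|k IH].
  by rewrite /= integral_cst//= probability_setT mule1.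
rewrite [h _]/= [v _]/= integral_affine// EFinD [X in (_ <= X + _)%E]EFinM leeD//.
by apply: lee_wpmul2l => //; rewrite lee_fin.
Qed.

Lemma dominated_bigO (V : nat -> T -> R) t (s : R) :
  P.-negligible (~` Om) -> (forall k w, 0 <= V k w) ->
  dominated V t -> - (t%:R / 10) <= s ->
  is_bigO (fun k => 'E_P[V k]%E) (fun k => k.+1%:R `^ s).
Proof.
move=> [N [mN PN ON]] V0 [h [m h0 hV [C C0 hC]]] ts.
exists C; near=> k; rewrite unlock.
rewrite gee0_abs ?integral_ge0//; last by move=> w _; rewrite lee_fin.
apply: (@le_trans _ _ (C * y k ^+ t)%:E); last first.
  rewrite lee_fin ler_wpM2l// (le_trans _ (ler_norm _))// decay_powR.
  by rewrite ler_powR// ler1n.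
apply: le_trans (hC k).
(* Since V may be non-measurable, the null set N is handled by raising the bound
   to +oo on it. *)
pose g w := ((h k w)%:E + (if w \in N then +oo else 0))%E.
have -> : (\int[P]_w (h k w)%:E = \int[P]_w g w)%E.
  apply: ge0_ae_eq_integral => //.
  - exact/measurable_EFinP.
  - apply: emeasurable_funD; first exact/measurable_EFinP.
    apply: measurable_fun_ifT => //; apply: (measurable_fun_bool true).
    rewrite setTI (_ : _ @^-1` _ = N)//; apply/seteqP.
    by split=> w /=; [move/set_mem | move=> ?; exact/mem_set].
  - by move=> w _; rewrite lee_fin.
  - by move=> w _; rewrite /g adde_ge0 ?lee_fin//; case: ifP.
  - exists N; split=> // w /= hw; apply: contrapT => wN; apply: hw => _.
    by rewrite /g ifF ?adde0//; apply/negbTE; rewrite notin_setE.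
apply: ge0_le_integral_nonmeasurable => w; first by rewrite lee_fin.
rewrite /g; case: ifPn => [_|]; first by rewrite addey// leey.
rewrite notin_setE => wN; rewrite adde0 lee_fin hV//.
by apply: contrapT => /ON.
Unshelve. all: by end_near.
Qed.

End Dominated.

(** * Linear filters of uncorrelated noise *)

Section SquareIntegrable.
Context d (T : measurableType d) (R : realType) (P : probability T R).
Implicit Types X Y Z : T -> R.
Local Open Scope ereal_scope.

Definition sqint X : Prop :=
  measurable_fun setT X /\ \int[P]_w ((X w ^+ 2)%R)%:E < +oo.

(** Orthogonality in L^2; for centered variables it is zero covariance. It is stable under linear
    combinations, which is what the filters require. *)
Definition uncorrelated X Y : Prop :=
  [/\ sqint X, sqint Y & \int[P]_w ((X w * Y w)%R)%:E = 0].

Lemma measurable_sqr X : measurable_fun setT X ->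
  measurable_fun setT (fun w => X w ^+ 2)%R.
Proof. by move=> mX; exact: measurable_funX. Qed.

Lemma sqint0 : sqint (fun=> 0%R).
Proof.
split; first exact: measurable_cst.
by rewrite integral0_eq ?ltry// => w _; rewrite expr2 mul0r.
Qed.

Lemma sqint_affine (a : R) X Y : sqint X -> sqint Y ->
  sqint (fun w => a * X w + Y w)%R.
Proof.
move=> [mX hX] [mY hY]; split.
  by apply: measurable_funD => //; exact: measurable_funM.
apply: (@le_lt_trans _ _
    (\int[P]_w (((2 * a ^+ 2) * X w ^+ 2 + 2 * Y w ^+ 2)%R)%:E)).
  apply: ge0_le_integral_nonmeasurable => w; rewrite lee_fin ?sqr_ge0//.
  rewrite -subr_ge0.
  have -> : (2 * a ^+ 2 * X w ^+ 2 + 2 * Y w ^+ 2 - (a * X w + Y w) ^+ 2)%R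
     = ((a * X w - Y w) ^+ 2)%R by ring.
  exact: sqr_ge0.
have mX2 := measurable_sqr mX; have mY2 := measurable_sqr mY.
rewrite integral_affine//.
- rewrite integral_scale//; last by move=> w; exact: sqr_ge0.
  rewrite lte_add_pinfty//.
  + by apply: lte_mul_pinfty => //; rewrite lee_fin; apply: mulr_ge0; rewrite ?sqr_ge0.
  + by apply: lte_mul_pinfty => //; rewrite lee_fin.
- by apply: mulr_ge0; rewrite ?sqr_ge0.
- exact: measurable_funM.
- by move=> w; exact: sqr_ge0.
- by move=> w; apply: mulr_ge0; rewrite ?sqr_ge0.
Qed.

Lemma sqint_sum n (a : 'I_n -> R) (X : 'I_n -> T -> R) :
  (forall i, sqint (X i)) -> sqint (fun w => \sum_i a i * X i w)%R.
Proof.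
move=> hX; elim: (index_enum _) => [|i s IH].
  by under eq_fun do rewrite big_nil; exact: sqint0.
by under eq_fun do rewrite big_cons; exact: sqint_affine.
Qed.

Lemma sqint_mul X Y : sqint X -> sqint Y ->
  P.-integrable setT (EFin \o (fun w => X w * Y w)%R).
Proof.
move=> [mX hX] [mY hY]; apply/integrableP; split.
  by apply/measurable_EFinP; exact: measurable_funM.
have mX2 := measurable_sqr mX; have mY2 := measurable_sqr mY.
apply: (@le_lt_trans _ _ (\int[P]_w ((1 * X w ^+ 2 + Y w ^+ 2)%R)%:E)).
  apply: ge0_le_integral_nonmeasurable => w /=; rewrite lee_fin// mul1r normrM.
  rewrite -(real_normK (num_real (X w))) -(real_normK (num_real (Y w))).
  have := sqr_ge0 (`|X w| - `|Y w|)%R.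
  have : (0 <= `|X w| * `|Y w|)%R by rewrite mulr_ge0.
  nra.
rewrite integral_affine//; try by move=> w; exact: sqr_ge0.
by rewrite mul1e lte_add_pinfty.
Qed.

Lemma sqint_sqr X : sqint X -> P.-integrable setT (EFin \o (fun w => X w ^+ 2)%R).
Proof. by move=> hX; exact: sqint_mul. Qed.

Lemma uncorrelatedC X Y : uncorrelated X Y -> uncorrelated Y X.
Proof.
by move=> [hX hY h0]; split=> //; under eq_integral do rewrite mulrC.
Qed.

Lemma uncorrelated_affine (a : R) X X' Y : uncorrelated X Y -> uncorrelated X' Y ->
  uncorrelated (fun w => a * X w + X' w)%R Y.
Proof.
move=> [hX hY h0] [hX' _ h0']; split=> //; first exact: sqint_affine.
under eq_integral do rewrite mulrDl -mulrA EFinD EFinM.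
rewrite integralD//=; last 2 first.
- by apply: integrableZl => //; exact: sqint_mul.
- exact: sqint_mul.
by rewrite integralZl//=; [rewrite h0 h0' mule0 adde0 | exact: sqint_mul].
Qed.

Lemma uncorrelated0 Y : sqint Y -> uncorrelated (fun=> 0%R) Y.
Proof.
move=> hY; split=> //; first exact: sqint0.
by under eq_integral do rewrite mul0r; rewrite integral0.
Qed.

Lemma uncorrelated_sum n (a : 'I_n -> R) (X : 'I_n -> T -> R) Y : sqint Y ->
  (forall i, uncorrelated (X i) Y) -> uncorrelated (fun w => \sum_i a i * X i w)%R Y.
Proof.
move=> hY hX; elim: (index_enum _) => [|i s IH].
  by under eq_fun do rewrite big_nil; exact: uncorrelated0.
by under eq_fun do rewrite big_cons; exact: uncorrelated_affine.
Qed.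

Lemma integral_sqrD X Y : uncorrelated X Y ->
  \int[P]_w (((X w + Y w) ^+ 2)%R)%:E =
  \int[P]_w ((X w ^+ 2)%R)%:E + \int[P]_w ((Y w ^+ 2)%R)%:E.
Proof.
move=> [hX hY h0].
transitivity (\int[P]_w ((2 * (X w * Y w))%R%:E + ((X w ^+ 2)%R%:E + (Y w ^+ 2)%R%:E))).
  by apply: eq_integral => w _; rewrite -!EFinD; congr _%:E; ring.
have iXY := sqint_mul hX hY; have iX := sqint_sqr hX; have iY := sqint_sqr hY.
rewrite integralD//=; last 2 first.
- by under eq_fun do rewrite EFinM; exact: integrableZl.
- exact: integrableD.
under eq_integral do rewrite EFinM.
by rewrite integralZl//= h0 mule0 add0e integralD.
Qed.

(** The law of the pair agrees with the product of the marginals on rectangles, hence everywhere.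
    Fubini's theorem then integrates out [X] first, which contributes its mean 0. *)
Lemma independent_uncorrelated (X Y : {RV P >-> R}) :
  (forall A B, measurable A -> measurable B ->
    P (X @^-1` A `&` Y @^-1` B) = P (X @^-1` A) * P (Y @^-1` B)) ->
  sqint X -> sqint Y -> 'E_P[X] = 0 -> uncorrelated X Y.
Proof.
move=> indep hX hY EX0; split=> //.
pose Z w : R * R := (X w, Y w).
have mZ : measurable_fun setT Z by exact: (measurable_fun_pair hX.1 hY.1).
pose Zm : {mfun T >-> (R * R)%type} := HB.pack Z (isMeasurableFun.Build _ _ _ _ Z mZ).
pose mXY : {measure set (R * R) -> \bar R} := distribution P Zm.
pose mX := distribution P X; pose mY := distribution P Y.
have prodE A : measurable A -> (mX \x mY) A = mXY A.
  apply: product_measure_unique => B C mB mC.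
  by rewrite -indep.
pose f (z : R * R) := (z.1 * z.2)%R%:E.
have mf : measurable_fun setT f.
  by apply/measurable_EFinP; apply: measurable_funM.
have intf : (mX \x mY).-integrable setT f.
  apply/integrableP; split => //.
  rewrite (eq_measure_integral mXY); last by move=> A mA _; exact: prodE.
  have mabs : measurable_fun setT (fun z => `|f z|) by exact: measurableT_comp.
  rewrite (ge0_integral_pushforward mZ _ measurableT mabs)//=.
  by have /integrableP[] := sqint_mul hX hY.
transitivity (\int[mXY]_z f z).
  by rewrite integral_pushforward//; exact: sqint_mul.
rewrite (eq_measure_integral (mX \x mY)); last by move=> A mA _; exact/esym/prodE.
rewrite -(integral21_prod_meas1 intf).
under eq_integral => b _.
  rewrite /fubini_G /f/=.
  under eq_integral do rewrite mulrC EFinM.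
  have iX : P.-integrable setT (EFin \o X).
    have h1 : sqint (fun=> 1%R).
      split; first exact: measurable_cst.
      by rewrite expr1n integral_cst//= probability_setT mule1 ltry.
    have := sqint_mul hX h1.
    by apply: eq_integrable => // w _ /=; rewrite mulr1.
  rewrite integralZl//; last exact: integrable_pushforward.
  rewrite (integral_pushforward _ _ iX)//.
  move: EX0; rewrite unlock /= => ->; rewrite mule0.
  over.
by rewrite integral0.
Qed.

Lemma centered_sqint (X : {RV P >-> R}) (s : R) : 'E_P[X] = 0 -> 'V_P[X] <= s%:E ->
  sqint X /\ \int[P]_w ((X w ^+ 2)%R)%:E <= s%:E.
Proof.
move=> EX0; rewrite /variance unlock EX0 /= unlock => h.
have h' : \int[P]_w ((X w ^+ 2)%R)%:E <= s%:E.
  apply: le_trans h; rewrite le_eqVlt; apply/orP; left; apply/eqP.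
  apply: eq_integral => w _.
  by rewrite (_ : (_ * _)%R w = (X w - 0) * (X w - 0))%R// subr0 expr2.
by split=> //; split; [exact: measurable_funPT | exact: le_lt_trans h' (ltry _)].
Qed.

End SquareIntegrable.

Section Filter.
Context d (T : measurableType d) (R : realType) (P : probability T R) (n : nat).
Variables (Q : nat -> 'M[R]_n) (zeta : nat -> T -> 'cV[R]_n).

Fixpoint filtered (k : nat) (w : T) : 'cV[R]_n :=
  if k is k'.+1 then Q k' *m filtered k' w + zeta k' w else 0.

Hypothesis zeta_sqint : forall k i, sqint P (fun w => zeta k w i 0).
Hypothesis zeta_uncorrelated : forall k l i j, (l < k)%N ->
  uncorrelated P (fun w => zeta l w i 0) (fun w => zeta k w j 0).

(** At time [m] the filter is a linear combination of the inputs before [m], each of them orthogonal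
    to the input at [k >= m]. *)
Lemma filtered_uncorrelated k m i j : (m <= k)%N ->
  uncorrelated P (fun w => filtered m w i 0) (fun w => zeta k w j 0).
Proof.
elim: m i => [|m IH] i mk.
  by under eq_fun do rewrite mxE; exact: uncorrelated0.
have -> : (fun w => filtered m.+1 w i 0) =
    (fun w => 1 * (\sum_l Q m i l * filtered m w l 0) + zeta m w i 0).
  by apply/funext => w; rewrite mul1r /= !mxE.
apply: uncorrelated_affine; last exact: zeta_uncorrelated.
by apply: uncorrelated_sum => // l; exact: IH (ltnW mk).
Qed.

Lemma filtered_sqint k i : sqint P (fun w => filtered k w i 0).
Proof. by have [] := filtered_uncorrelated i i (leqnn k). Qed.

Lemma mulmx_sqint (B : 'M[R]_n) (X : T -> 'cV[R]_n) i :
  (forall j, sqint P (fun w => X w j 0)) -> sqint P (fun w => (B *m X w) i 0).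
Proof. by move=> hX; under eq_fun do rewrite mxE; exact: sqint_sum. Qed.

Lemma qf_measurable (B : 'M[R]_n) (X : T -> 'cV[R]_n) :
  (forall j, sqint P (fun w => X w j 0)) -> measurable_fun setT (fun w => qf B (X w)).
Proof.
move=> hX; rewrite /qf; apply: measurable_sum => i.
by apply: measurable_sqr; have [] := mulmx_sqint B i hX.
Qed.

Lemma integral_qf (B : 'M[R]_n) (X : T -> 'cV[R]_n) :
  (forall j, sqint P (fun w => X w j 0)) ->
  (\int[P]_w (qf B (X w))%:E = \sum_i \int[P]_w (((B *m X w) i 0) ^+ 2)%:E)%E.
Proof.
move=> hX; under eq_integral do rewrite /qf -sumEFin.
rewrite ge0_integral_sum// => i; last by move=> w _; rewrite lee_fin sqr_ge0.
by apply/measurable_EFinP; apply: measurable_sqr; have [] := mulmx_sqint B i hX.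
Qed.

(** The cross terms vanish coordinate by coordinate, so the variance recursion is exact: the input
    enters with its own second moment, not divided by the contraction gain as under Young's
    inequality. *)
Lemma integral_qf_filteredS (B : 'M[R]_n) k :
  (\int[P]_w (qf B (filtered k.+1 w))%:E =
   \int[P]_w (qf B (Q k *m filtered k w))%:E + \int[P]_w (qf B (zeta k w))%:E)%E.
Proof.
have hQ j : sqint P (fun w => (Q k *m filtered k w) j 0).
  by apply: mulmx_sqint => l; exact: filtered_sqint.
rewrite !integral_qf//; last by move=> j; exact: filtered_sqint.
rewrite -big_split; apply: eq_bigr => i _ /=.
rewrite -integral_sqrD; last first.
  under eq_fun do rewrite mxE.
  under [X in uncorrelated _ _ X]eq_fun do rewrite mxE.
  apply: uncorrelated_sum => [|j].
    by apply: sqint_sum => j.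
  apply: uncorrelatedC; apply: uncorrelated_sum => // l.
  apply: uncorrelatedC; under eq_fun do rewrite mxE.
  by apply: uncorrelated_sum => // m; exact: filtered_uncorrelated.
by apply: eq_integral => w _; rewrite mulmx_addE.
Qed.

Lemma filtered_dominated (Om : set T) (B : 'M[R]_n) (c C : R) (s t : nat) :
  0 < c <= 1 -> (s <= 9)%N -> 0 <= C ->
  (forall k w, qf B (Q k *m filtered k w) <=
     (1 - c * decay R k ^+ s) * qf B (filtered k w)) ->
  (forall k, (\int[P]_w (qf B (zeta k w))%:E <= (C * decay R k ^+ (s + t))%:E)%E) ->
  dominated P Om (fun k w => qf B (filtered k w)) t.
Proof.
move=> /andP[c0 c1] s9 C0 contr var.
pose A k := 1 - c * decay R k ^+ s.
have A0 k : 0 <= A k by rewrite subr_ge0 mulr_ile1 ?decayX_ge0 ?decayX_le1// ltW.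
pose v := fix v k := if k is k'.+1 then A k' * v k' + C * decay R k' ^+ (s + t) else 0 : R.
have v0 k : 0 <= v k.
  by elim: k => //= k IH; rewrite addr_ge0 ?mulr_ge0 ?decayX_ge0.
have [M M0 HM] := chung c0 s9 C0 v0 A0 (K := 0%N) (fun k _ => lexx (A k)) (fun k => lexx (v k.+1)).
exists (fun k w => qf B (filtered k w)); split=> // [k|k w|].
- by apply: qf_measurable => j; exact: filtered_sqint.
- exact: qf_ge0.
exists M => // k; apply: (@le_trans _ _ (v k)%:E); last by rewrite lee_fin.
elim: k => [|k IH].
  by under eq_integral do rewrite qf0; rewrite integral0.
rewrite integral_qf_filteredS [v _]/= EFinD leeD//.
apply: (@le_trans _ _ (\int[P]_w (A k * qf B (filtered k w))%:E)%E).
  by apply: ge0_le_integral_nonmeasurable => w; rewrite lee_fin ?qf_ge0.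
rewrite integral_scale//.
- by rewrite [leRHS]EFinM; apply: lee_wpmul2l => //; rewrite lee_fin.
- by apply: qf_measurable => j; exact: filtered_sqint.
- by move=> w; exact: qf_ge0.
Qed.

End Filter.

(** * Convergence of kappa *)

Section Kappa.
Variable R : realType.
Local Notation y := (@decay R).

(* As [chung], but with a constant that does not depend on the sequence, hence
   not on the realization of the noise. *)
Lemma chung_uniform (c C v0 : R) (s t : nat) : 0 < c <= 1 -> (s <= 9)%N -> 0 <= C ->
  exists2 M, 0 <= M & forall v : nat -> R, v 0%N <= v0 ->
    (forall k, v k.+1 <= (1 - c * y k ^+ s) * v k + C * y k ^+ (s + t)) ->
    forall k, v k <= M * y k ^+ t.
Proof.
move=> /andP[c0 c1] s9 C0.
have A0 k : 0 <= 1 - c * y k ^+ s.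
  by rewrite subr_ge0 mulr_ile1 ?decayX_ge0 ?decayX_le1// ltW.
pose u := fix u k := if k is k'.+1
  then (1 - c * y k' ^+ s) * u k' + C * y k' ^+ (s + t) else `|v0|.
have u0 k : 0 <= u k.
  by elim: k => //= k IH; rewrite addr_ge0 ?mulr_ge0 ?decayX_ge0.
have [M M0 HM] := chung c0 s9 C0 u0 A0 (K := 0%N)
  (fun k _ => lexx _) (fun k => lexx (u k.+1)).
exists M => // v hv0 rec k; apply: le_trans (HM k).
elim: k => [|k IH]; first exact: le_trans hv0 (ler_norm _).
by apply: (le_trans (rec k)); rewrite /= lerD2r ler_wpM2l.
Qed.

(** [cumul 2] accumulates [gamma], the growth of the y-iterates; [cumul 5] accumulates [lambda], the
    worst case for their averaged noise. *)
Definition cumul (m : nat) (k : nat) : R := \sum_(j < k) y j ^+ m.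

Lemma cumulS m k : cumul m k.+1 = cumul m k + y k ^+ m.
Proof. exact: big_ord_recr. Qed.

(** With [p^2 = k + 1] and [q^2 = k + 2], the induction step is [(3 p + 1/p)^2 <= 9 p^2 + 6 + 1 <=
    (3 q)^2]. *)
Lemma cumul5_le k : cumul 5 k <= 3 * (y k ^+ 5)^-1.
Proof.
elim: k => [|k IH]; first by rewrite /cumul big_ord0 mulr_ge0// invr_ge0 decayX_ge0.
rewrite cumulS; apply: (@le_trans _ _ (3 * (y k ^+ 5)^-1 + y k ^+ 5)).
  by rewrite lerD2r.
have sq j : ((y j ^+ 5)^-1) ^+ 2 = j.+1%:R.
  by rewrite exprVn -exprM decay_exp10 invrK.
have := sq k; have := sq k.+1; rewrite -[k.+2%:R]natr1 => + sk; rewrite -sk {sk}.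
have p0 j : 0 < (y j ^+ 5)^-1 by rewrite invr_gt0 decayX_gt0.
have p1 : 1 <= (y k ^+ 5)^-1 by rewrite invf_ge1 ?decayX_gt0 ?decayX_le1.
rewrite -[X in _ + X <= _]invrK.
move: (p0 k) (p0 k.+1) p1; set p := (y k ^+ 5)^-1; set q := (y k.+1 ^+ 5)^-1.
move=> pp qq p1 e.
have pV1 : p^-1 <= 1 by rewrite invf_le1.
have pVp : p * p^-1 = 1 by rewrite mulfV// gt_eqF.
have pV0 : 0 <= p^-1 by rewrite invr_ge0 ltW.
rewrite -(@ler_pXn2r _ 2) ?nnegrE ?addr_ge0 ?mulr_ge0 ?(ltW pp) ?(ltW qq)//.
have -> : (3 * p + p^-1) ^+ 2 = 9 * p ^+ 2 + 6 * (p * p^-1) + p^-1 ^+ 2 by ring.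
rewrite pVp exprMn e.
have : p^-1 ^+ 2 <= 1 by rewrite exprn_ile1.
lra.
Qed.

Lemma decay_nonincreasing j k : (j <= k)%N -> y k <= y j.
Proof.
elim: k => [|k IH]; first by rewrite leqn0 => /eqP ->.
rewrite leq_eqVlt => /orP[/eqP -> //|/IH]; exact: le_trans (decayS_le _ _).
Qed.

(** The smallest possible summand is [y k ^+ 2], and [y k ^- 8] equals [(k + 1) y k ^+ 2]; the extra
    summand is at most 1. *)
Lemma cumul2_ge k : y k ^- 8 <= 1 + cumul 2 k.
Proof.
have h : k%:R * y k ^+ 2 <= cumul 2 k.
  rewrite mulr_natl -[X in _ *+ X]card_ord -sumr_const; apply: ler_sum => j _.
  by rewrite lerXn2r ?nnegrE ?decay_ge0// decay_nonincreasing// ltnW.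
apply: (@le_trans _ _ (y k ^+ 2 + k%:R * y k ^+ 2)).
  rewrite -{1}[y k ^+ 2]mul1r -mulrDl addrC natr1.
  have -> : k.+1%:R = (y k ^+ 10)^-1 :> R by rewrite decay_exp10 invrK.
  rewrite le_eqVlt; apply/orP; left; apply/eqP.
  by field; rewrite gt_eqF// decay_gt0.
by rewrite lerD// decayX_le1.
Qed.

Variables (n : nat) (W : 'M[R]_n) (r : 'cV[R]_n).
Hypotheses (W1 : W *m ones R n = ones R n) (rW : r^T *m W = r^T)
  (r1 : \sum_i r i 0 = 1) (r_gt0 : forall i, 0 < r i 0).
Variables (A : 'M[R]_n) (rho : R).
Hypotheses (rho_gt0 : 0 < rho) (rho_le1 : rho <= 1).
Hypothesis contr : forall v, qf A ((W - ones R n *m r^T) *m v) <= (1 - rho) * qf A v.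
Hypothesis scale : forall v : 'cV[R]_n, \sum_i v i 0 ^+ 2 <= qf A v.
Variables (s epsk : R).
Hypotheses (s0 : 0 <= s) (epsk0 : 0 < epsk).

(** Stated for arbitrary sequences, so that the constants found below hold for all realizations of
    the noise at once. *)
Definition y_recursion (E Y : nat -> 'M[R]_n) : Prop :=
  [/\ forall k i, \sum_j E k i j ^+ 2 <= s, Y 0%N = 1%:M & forall k,
    Y k.+1 = lazy W (y k ^+ 5) *m Y k + y k ^+ 5 *: E k + y k ^+ 2 *: 1%:M].

Lemma y_noise_sqr (E Y : nat -> 'M[R]_n) k i j : y_recursion E Y -> E k i j ^+ 2 <= s.
Proof.
move=> [/(_ k i) hE _ _]; apply: le_trans hE.
by rewrite (bigD1 j)//= lerDl sumr_ge0// => l _; rewrite sqr_ge0.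
Qed.

(** Column [j] collects the [j]-th components of all agents, and [W] mixes within columns. Relative
    to [lambda] the input is at most of order [gamma / lambda = y^(-3)], so the deviation weighted
    by [y^6] has bounded forcing; the decrease of the weight only helps. *)
Lemma y_deviation : exists2 K, 0 <= K &
  forall E Y, y_recursion E Y -> forall k j, qf A (dev r *m col j (Y k)) <= K * y k ^- 6.
Proof.
have [C1 C10 HC1] := qf_bound (A *m dev r).
have qdev v : qf A (dev r *m v) <= C1 * \sum_i v i 0 ^+ 2.
  by have := HC1 v; rewrite /qf -mulmxA.
pose C := (1 + 2 / rho) * (C1 * (2 * (n%:R * s + 1))).
have c01 : 0 < rho / 2 <= 1 by apply/andP; split; move: rho_gt0 rho_le1; lra.
have C0 : 0 <= C.
  by rewrite /C !mulr_ge0// ?addr_ge0 ?mulr_ge0// ltW// invr_gt0.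
have dsum j : \sum_i (delta_mx j 0 : 'cV[R]_n) i 0 ^+ 2 = 1.
  rewrite (bigD1 j)//= mxE !eqxx expr1n big1 ?addr0// => i /negbTE ij.
  by rewrite mxE ij expr0n.
have [M M0 HM] := chung_uniform C1 0 c01 (isT : (5 <= 9)%N) C0.
exists M => // E Y hY k j; have [hE Y0 hrec] := hY.
have y6 k' : 0 < y k' ^+ 6 by exact: decayX_gt0.
rewrite ler_pdivlMr// mulrC -[M]mulr1 -(expr0 (y k)).
apply: (HM (fun k => y k ^+ 6 * qf A (dev r *m col j (Y k)))) => [|{}k].
  apply: (@le_trans _ _ (1 * qf A (dev r *m col j (Y 0%N)))).
    by rewrite ler_wpM2r ?qf_ge0// decayX_le1.
  rewrite mul1r; apply: (le_trans (qdev _)).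
  rewrite Y0 (_ : col j 1%:M = delta_mx j 0) ?dsum ?mulr1//.
  by apply/matrixP => i i'; rewrite !mxE ord1 eqxx andbT.
set l := y k ^+ 5; have l0 : 0 < l by exact: decayX_gt0.
have l1 : l <= 1 by exact: decayX_le1.
pose w := col j (E k) + y k ^- 3 *: delta_mx j 0.
have colE : dev r *m col j (Y k.+1) =
    lazy W l *m (dev r *m col j (Y k)) + l *: (dev r *m w).
  rewrite lazy_dev// scalemxAr -mulmxDr hrec; congr (_ *m _).
  rewrite /w scalerDr scalerA.
  have -> : l * y k ^- 3 = y k ^+ 2 by rewrite /l (exprD _ 2 3) mulfK// gt_eqF// decayX_gt0.
  have -> : delta_mx j 0 = col j 1%:M :> 'cV[R]_n.
    by apply/matrixP => i i'; rewrite !mxE ord1 eqxx andbT.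
  apply/matrixP => i i'; rewrite !mxE addrA; congr (_ + _ + _).
  by apply: eq_bigr => m _; rewrite !mxE.
have ctr0 : r^T *m (dev r *m col j (Y k)) = 0 by rewrite mulmxA trmx_dev// mul0mx.
have l01 : 0 < l <= 1 by rewrite l0.
have hw : y k ^+ 6 * qf A (dev r *m w) <= C1 * (2 * (n%:R * s + 1)).
  apply: (@le_trans _ _ (y k ^+ 6 * (C1 * \sum_i w i 0 ^+ 2))).
    by rewrite ler_wpM2l ?(ltW (y6 k))// qdev.
  rewrite mulrCA ler_wpM2l//.
  apply: (@le_trans _ _ (y k ^+ 6 * (2 * (n%:R * s + y k ^- 6)))).
    rewrite ler_wpM2l ?(ltW (y6 k))//.
    apply: (@le_trans _ _ (\sum_i 2 * (E k i j ^+ 2 + y k ^- 6 * (delta_mx j 0 : 'cV[R]_n) i 0 ^+ 2))).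
      apply: ler_sum => i _; rewrite !mxE.
      set a := E k i j; set b := (_ && _)%:R : R.
      have -> : y k ^- 6 * b ^+ 2 = (y k ^- 3 * b) ^+ 2 by rewrite exprMn exprVn -exprM.
      by have := sqr_ge0 (a - y k ^- 3 * b); nra.
    rewrite -mulr_sumr ler_wpM2l// big_split/= -mulr_sumr dsum mulr1 lerD2r.
    rewrite mulr_natl -[X in _ *+ X]card_ord -sumr_const; apply: ler_sum => i _.
    exact: y_noise_sqr hY.
  rewrite mulrCA ler_wpM2l// mulrDr mulfV ?gt_eqF// lerD2r.
  by rewrite ler_piMl ?mulr_ge0// decayX_le1.
rewrite colE.
apply: (@le_trans _ _ (y k ^+ 6 * ((1 - l * rho / 2) * qf A (dev r *m col j (Y k)) +
    l * (1 + 2 / rho) * qf A (dev r *m w)))).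
  apply: (@le_trans _ _ (y k ^+ 6 *
    qf A (lazy W l *m (dev r *m col j (Y k)) + l *: (dev r *m w)))).
    rewrite ler_wpM2r ?qf_ge0// lerXn2r ?nnegrE ?decay_ge0//.
    exact: decayS_le.
  by rewrite ler_wpM2l ?(ltW (y6 k))//; exact: (qf_lazy_step (r := r)).
rewrite mulrDr; apply: lerD.
  by rewrite mulrCA (_ : l * rho / 2 = rho / 2 * l)//; ring.
have -> : y k ^+ 6 * (l * (1 + 2 / rho) * qf A (dev r *m w)) =
  l * ((1 + 2 / rho) * (y k ^+ 6 * qf A (dev r *m w))) by ring.
rewrite [leRHS]mulrC ler_wpM2l ?(ltW l0)//.
by apply: ler_wpM2l => //; rewrite addr_ge0// divr_ge0// ltW.
Qed.

(** The [r]-average of column [j] starts at [r_j] and gains exactly [gamma r_j] per step; its noise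
    is summed in absolute value by [cumul 5]. The deviation from this average is only of order
    [y^(-3)]. *)
Lemma y_bound : exists2 K, 0 <= K & forall E Y, y_recursion E Y ->
  forall k i j, `|Y k i j - r j 0 * (1 + cumul 2 k)| <= K * y k ^- 5.
Proof.
have [K K0 HK] := y_deviation.
(* [S] and [K + 1] replace the square roots of [s] and [K], since [t <= (t + 1)^2] for [t >= 0]. *)
pose S := s + 1.
exists (K + 1 + 3 * S) => [|E Y hY k i j].
  by rewrite /S !addr_ge0// mulr_ge0// addr_ge0.
have [hE Y0 hrec] := hY.
pose c k := col j (Y k).
have avg m : `|wavg r (c m) - r j 0 * (1 + cumul 2 m)| <= S * cumul 5 m.
  elim: m => [|m IH].
    rewrite /cumul !big_ord0 addr0 mulr0 mulr1 /c Y0 /wavg mxE.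
    rewrite (bigD1 j)//= !mxE eqxx mulr1 big1 ?addr0 ?subrr ?normr0// => l /negbTE lj.
    by rewrite !mxE lj mulr0.
  have -> : wavg r (c m.+1) = wavg r (c m) + y m ^+ 5 * wavg r (col j (E m)) + y m ^+ 2 * r j 0.
    rewrite /wavg /c hrec.
    have -> : col j (lazy W (y m ^+ 5) *m Y m + y m ^+ 5 *: E m + y m ^+ 2 *: 1%:M) =
       lazy W (y m ^+ 5) *m col j (Y m) + y m ^+ 5 *: col j (E m) + y m ^+ 2 *: col j 1%:M.
      apply/matrixP => l l'; rewrite !mxE; congr (_ + _ + _).
      by apply: eq_bigr => q _; rewrite !mxE.
    rewrite !mulmxDr trmx_lazy// -!scalemxAr.
    have -> : (r^T *m col j 1%:M) = (r j 0)%:M.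
      apply/matrixP => l l'; rewrite !ord1 !mxE eqxx mulr1n (bigD1 j)//= !mxE eqxx mulr1.
      by rewrite big1 ?addr0// => q /negbTE qj; rewrite !mxE qj mulr0.
    by rewrite !mxE eqxx mulr1n.
  rewrite !cumulS.
  have -> : wavg r (c m) + y m ^+ 5 * wavg r (col j (E m)) + y m ^+ 2 * r j 0 -
     r j 0 * (1 + (cumul 2 m + y m ^+ 2)) =
     (wavg r (c m) - r j 0 * (1 + cumul 2 m)) + y m ^+ 5 * wavg r (col j (E m)) by ring.
  apply: (le_trans (ler_normD _ _)); rewrite [leRHS]mulrDr lerD// normrM.
  rewrite (ger0_norm (decayX_ge0 _ _ _)) mulrC ler_wpM2r ?decayX_ge0//.
  rewrite /wavg mxE; apply: (le_trans (ler_norm_sum _ _ _)).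
  rewrite -[S]mul1r -r1 mulr_suml; apply: ler_sum => l _.
  rewrite !mxE normrM (gtr0_norm (r_gt0 _)) ler_wpM2l ?(ltW (r_gt0 _))//.
  rewrite -(@ler_pXn2r _ 2) ?nnegrE ?addr_ge0// real_normK ?num_real//.
  by apply: (le_trans (y_noise_sqr _ _ _ hY)); rewrite /S; nra.
have -> : Y k i j = wavg r (c k) + (dev r *m c k) i 0.
  by rewrite -dev_wavg; set a := wavg _ _; rewrite !mxE mulr1 [a + _]addrC subrK.
rewrite addrAC; apply: (le_trans (ler_normD _ _)); rewrite [leLHS]addrC [leRHS]mulrDl.
have y5 : 0 < y k ^+ 5 by exact: decayX_gt0.
apply: lerD; last first.
  apply: (le_trans (avg k)); rewrite [3 * S]mulrC -mulrA ler_wpM2l ?cumul5_le//.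
  by rewrite addr_ge0.
have y3 : 0 < y k ^- 3 by rewrite invr_gt0 decayX_gt0.
apply: (@le_trans _ _ ((K + 1) * y k ^- 3)).
  rewrite -(@ler_pXn2r _ 2) ?nnegrE ?mulr_ge0 ?addr_ge0 ?(ltW y3)//.
  rewrite real_normK ?num_real// exprMn exprVn -exprM.
  apply: (@le_trans _ _ (qf A (dev r *m c k))).
    apply: le_trans (scale _).
    by rewrite (bigD1 i)//= lerDl sumr_ge0// => l _; rewrite sqr_ge0.
  apply: (le_trans (HK _ _ hY k j)).
  by rewrite ler_wpM2r ?invr_ge0 ?decayX_ge0//; nra.
rewrite ler_wpM2l ?addr_ge0// lef_pV2 ?posrE ?decayX_gt0//.
exact: decayX_le.
Qed.

End Kappa.

(** * From the y-iterates to kappa *)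

Section KappaLimit.
Variable R : realType.
Local Notation y := (@decay R).
Variables (n : nat) (r : 'cV[R]_n) (K epsk : R).
Hypotheses (r1 : \sum_i r i 0 = 1) (r_gt0 : forall i, 0 < r i 0).
Hypotheses (K0 : 0 <= K) (epsk0 : 0 < epsk).
Local Notation G k := (1 + cumul R 2 k).

Definition kappa_recursion (Y : nat -> 'M[R]_n) (kap : nat -> 'cV[R]_n) : Prop :=
  [/\ forall k i j, `|Y k i j - r j 0 * G k| <= K * y k ^- 5, kap 0%N = 0 &
      forall k, kap k.+1 = \col_i (if epsk < Y k.+1 i i
        then (\sum_j Y k.+1 i j) / (n%:R * Y k.+1 i i) else kap k i 0)].

Lemma G_ge1 k : 1 <= G k.
Proof. by rewrite lerDl sumr_ge0// => j _; rewrite decayX_ge0. Qed.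

Lemma row_sum_close Y kap k i : kappa_recursion Y kap ->
  `|\sum_j Y k i j - G k| <= n%:R * K * y k ^- 5.
Proof.
move=> [hY _ _].
have {1}-> : G k = \sum_j r j 0 * G k by rewrite -mulr_suml r1 mul1r.
rewrite -sumrB.
apply: (le_trans (ler_norm_sum _ _ _)).
apply: (@le_trans _ _ (\sum_(j < n) K * y k ^- 5)); first by apply: ler_sum => j _; exact: hY.
by rewrite sumr_const card_ord -[X in X <= _]mulr_natl mulrA.
Qed.

(** A crude bound, used only for finitely many times. A fresh value has its denominator above
    [n epsk]; a kept value inherits the previous bound, which grows with [k]. *)
Lemma kappa_bounded Y kap k i : kappa_recursion Y kap -> (0 < n)%N ->
  `|kap k i 0| <= (G k + n%:R * K * y k ^- 5) / (n%:R * epsk).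
Proof.
move=> hY n0; have [h kap0 hk] := hY.
have ne0 : 0 < n%:R * epsk by rewrite mulr_gt0// ltr0n.
have K5 j : 0 <= n%:R * K * y j ^- 5 by apply: mulr_ge0; [exact: mulr_ge0 | rewrite invr_ge0 decayX_ge0].
have G0 j : 0 <= G j := le_trans ler01 (G_ge1 j).
elim: k => [|k IH].
  rewrite kap0 mxE normr0; apply: divr_ge0; last exact: ltW.
  by apply: addr_ge0; [exact: G0 | exact: K5].
rewrite hk mxE; case: ifPn => [eY|_]; last first.
  apply: (le_trans IH); rewrite ler_pM2r ?invr_gt0// lerD//.
    by rewrite cumulS addrA lerDl decayX_ge0.
  rewrite ler_wpM2l ?mulr_ge0// lef_pV2 ?posrE ?decayX_gt0//.
  by rewrite lerXn2r ?nnegrE ?decay_ge0// decayS_le.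
have Y0 : 0 < Y k.+1 i i := lt_trans epsk0 eY.
rewrite normrM; apply: ler_pM => //.
  rewrite -[\sum_j _](subrK (G k.+1)); apply: (le_trans (ler_normD _ _)).
  by rewrite addrC lerD ?(row_sum_close _ _ hY)// ger0_norm.
rewrite ger0_norm ?invr_ge0; last by rewrite mulr_ge0 ?(ltW Y0).
rewrite lef_pV2 ?posrE//; last by rewrite mulr_gt0// ltr0n.
by rewrite ler_wpM2l// ltW.
Qed.

(** Eventually the diagonal entry is at least [r_i G / 2] and exceeds [epsk], so kappa is refreshed
    at every step. The error is then a quotient with numerator of order [y^(-5)] and denominator of
    order [G >= y^(-8)]. *)
Lemma kappa_limit_coord i : (0 < n)%N -> exists2 C, 0 <= C &
  forall Y kap, kappa_recursion Y kap ->
  forall k, `|kap k.+1 i 0 - (n%:R * r i 0)^-1| <= C * y k ^+ 3.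
Proof.
move=> n0; have ri := r_gt0 i; set ri0 := r i 0 in ri *.
have nR : 0 < n%:R :> R by rewrite ltr0n.
have ri_ge0 := ltW ri.
have [N1 HN1] : exists N1, forall k, (N1 <= k)%N -> K * y k ^+ 3 <= ri0 / 2.
  have e0 : 0 < ri0 / 2 / (K + 1) by rewrite !divr_gt0// ltr_wpDl.
  have [N1 H] := decay_small e0.
  exists N1 => k /H; rewrite ler_pdivlMr ?ltr_wpDl// => h.
  apply: le_trans h; rewrite mulrC; apply: ler_pM; rewrite ?decayX_ge0//.
    by rewrite -[leRHS]expr1 decayX_le.
  by rewrite lerDl.
have [N2 HN2] : exists N2, forall k, (N2 <= k)%N -> epsk * y k ^+ 8 < ri0 / 2.
  have e0 : 0 < ri0 / 2 / (epsk + 1) by rewrite !divr_gt0// addr_gt0.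
  have [N2 H] := decay_small e0.
  exists N2 => k /H; rewrite ler_pdivlMr ?addr_gt0// => h.
  apply: lt_le_trans h; rewrite mulrC.
  apply: (@le_lt_trans _ _ (y k * epsk)).
    by rewrite ler_wpM2r ?(ltW epsk0)// -[leRHS]expr1 decayX_le.
  by rewrite ltr_pM2l ?decay_gt0// ltrDl.
pose N0 := maxn N1 N2.
pose b k := (G k.+1 + n%:R * K * y k.+1 ^- 5) / (n%:R * epsk) + (n%:R * ri0)^-1.
have [M M0 HM] := finite_bound b 3 N0.
(* The numerator collects the errors of the row sum and of the diagonal entry; the denominator uses
   the lower bound [ri0 / 2 * G] for that entry. *)
pose C := (ri0 * n%:R * K + K) / (n%:R * ri0 * (ri0 / 2)).
have C0 : 0 <= C.
  by apply: divr_ge0; [apply: addr_ge0 | apply: mulr_ge0]; rewrite ?mulr_ge0 ?divr_ge0.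
exists (M + C) => [|Y kap hY k]; first exact: addr_ge0.
have [h _ hk] := hY.
have [kN|Nk] := leqP k N0.
  apply: (@le_trans _ _ (b k)); last first.
    by apply: (le_trans (HM _ kN)); rewrite ler_wpM2r ?decayX_ge0// lerDl.
  apply: (le_trans (ler_normB _ _)); apply: lerD.
    exact: kappa_bounded hY n0.
  by rewrite ger0_norm// invr_ge0 mulr_ge0.
apply: (@le_trans _ _ (C * y k.+1 ^+ 3)); last first.
  apply: (@le_trans _ _ (C * y k ^+ 3)).
    by rewrite ler_wpM2l// lerXn2r ?nnegrE ?decay_ge0// decayS_le.
  by rewrite ler_wpM2r ?decayX_ge0// lerDr.
set j := k.+1.
have N1j : (N1 <= j)%N by rewrite (leq_trans (leq_maxl N1 N2))// ltnW// ltnW.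
have N2j : (N2 <= j)%N by rewrite (leq_trans (leq_maxr N1 N2))// ltnW// ltnW.
have G8 : y j ^- 8 <= G j := cumul2_ge _ j.
have G0 : 0 < G j := lt_le_trans ltr01 (G_ge1 j).
have y5 : y j ^- 5 <= y j ^+ 3 * G j.
  apply: (@le_trans _ _ (y j ^+ 3 * y j ^- 8)); last by rewrite ler_wpM2l ?decayX_ge0.
  rewrite le_eqVlt; apply/orP; left; apply/eqP; field.
  by rewrite gt_eqF// decay_gt0.
have Ylo : ri0 / 2 * G j <= Y j i i.
  have := h j i i; rewrite ler_norml => /andP[lo _].
  have h1 : K * y j ^- 5 <= ri0 / 2 * G j.
    apply: (@le_trans _ _ (K * (y j ^+ 3 * G j))); first by rewrite ler_wpM2l.
    by rewrite mulrA ler_wpM2r ?(ltW G0)// HN1.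
  by move: lo h1; rewrite -/ri0; lra.
have eY : epsk < Y j i i.
  apply: lt_le_trans Ylo; apply: (@lt_le_trans _ _ (ri0 / 2 * y j ^- 8)).
    by rewrite ltr_pdivlMr ?decayX_gt0// HN2.
  by rewrite ler_wpM2l// divr_ge0// ltW.
have Y0 : 0 < Y j i i := lt_trans epsk0 eY.
rewrite hk mxE eY.
set num := \sum_j0 _.
have -> : num / (n%:R * Y j i i) - (n%:R * ri0)^-1 =
   (ri0 * (num - G j) - (Y j i i - ri0 * G j)) / (n%:R * ri0 * Y j i i).
  by field; rewrite !gt_eqF.
rewrite normrM normfV [X in _ / X]ger0_norm; last by rewrite !mulr_ge0 ?(ltW ri) ?(ltW Y0).
rewrite ler_pdivrMr ?mulr_gt0//.
apply: (@le_trans _ _ ((ri0 * n%:R * K + K) * y j ^- 5)).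
  apply: (le_trans (ler_normB _ _)); rewrite [leRHS]mulrDl lerD//.
  rewrite normrM (gtr0_norm ri) -!mulrA ler_wpM2l ?(ltW ri)//.
  by rewrite mulrA; exact: row_sum_close hY.
apply: (@le_trans _ _ ((ri0 * n%:R * K + K) * (y j ^+ 3 * G j))).
  by rewrite ler_wpM2l// addr_ge0 ?mulr_ge0// ltW.
apply: (@le_trans _ _ (C * y j ^+ 3 * (n%:R * ri0 * (ri0 / 2 * G j)))).
  rewrite le_eqVlt; apply/orP; left; apply/eqP; rewrite /C; field.
  by rewrite !gt_eqF.
apply: ler_wpM2l; first by apply: mulr_ge0; rewrite ?decayX_ge0.
by apply: ler_wpM2l => //; apply: mulr_ge0.
Qed.

Lemma kappa_limit : (0 < n)%N -> exists2 C, 0 <= C &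
  forall Y kap, kappa_recursion Y kap ->
  forall k i, `|kap k.+1 i 0 - (n%:R * r i 0)^-1| <= C * y k ^+ 3.
Proof.
move=> n0.
have /boolp.choice[C HC] : forall i, exists C, 0 <= C /\
    forall Y kap, kappa_recursion Y kap ->
    forall k, `|kap k.+1 i 0 - (n%:R * r i 0)^-1| <= C * y k ^+ 3.
  by move=> i; have [C C0 HC] := kappa_limit_coord i n0; exists C.
exists (\sum_i C i) => [|Y kap hY k i].
  by rewrite sumr_ge0// => i _; have [] := HC i.
apply: (le_trans ((HC i).2 _ _ hY k)); rewrite ler_wpM2r ?decayX_ge0//.
by rewrite (bigD1 i)//= lerDl sumr_ge0// => l _; have [] := HC l.
Qed.

End KappaLimit.

(** * Pathwise recursions *)

Lemma entry_sqr_le_qf (R : realType) (n : nat) (A : 'M[R]_n) (v : 'cV[R]_n) i :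
  (forall v : 'cV[R]_n, \sum_i v i 0 ^+ 2 <= qf A v) -> v i 0 ^+ 2 <= qf A v.
Proof.
move=> h; apply: le_trans (h v).
by rewrite (bigD1 i)//= lerDl sumr_ge0// => l _; rewrite sqr_ge0.
Qed.

Section Path.
Variable R : realType.
Local Notation y := (@decay R).
Variables (n : nat) (W : 'M[R]_n) (r : 'cV[R]_n).
Hypotheses (W1 : W *m ones R n = ones R n) (rW : r^T *m W = r^T)
  (r1 : \sum_i r i 0 = 1) (r_gt0 : forall i, 0 < r i 0) (n_gt0 : (0 < n)%N).
Variables (A : 'M[R]_n) (rho : R).
Hypothesis rho_gt0 : 0 < rho.
Hypothesis contr : forall v, qf A ((W - ones R n *m r^T) *m v) <= (1 - rho) * qf A v.
Hypothesis scale : forall v : 'cV[R]_n, \sum_i v i 0 ^+ 2 <= qf A v.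
Variables (f : 'I_n -> R -> R) (mu L xs ca : R).
Hypotheses (mu0 : 0 < mu) (L0 : 0 < L) (ca0 : 0 < ca) (caL : ca * (L + mu) <= 1).
Hypotheses (hc : forall i, strongly_convex mu (f i)) (hs : forall i, smooth L (f i)).
Hypothesis hxs : minimizer (average f) xs.
Variable (Ck : R).
Hypothesis Ck0 : 0 <= Ck.

(* One realization of the iterates, the noise and the noise filters.  [pk p k] is
   kappa_k, that is, [st_kappa] at time k.+1. *)
Record path := Path {
  px : nat -> 'cV[R]_n; pz : nat -> 'cV[R]_n; pk : nat -> 'cV[R]_n;
  pex : nat -> 'cV[R]_n; pez : nat -> 'cV[R]_n;
  pNx : nat -> 'cV[R]_n; pNz : nat -> 'cV[R]_n; pxi : nat -> R }.

Definition pg (p : path) k : 'cV[R]_n :=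
  \col_i (pk p k i 0 * derive1 (f i) (px p k i 0)).

Record is_path (p : path) : Prop := IsPath {
  path_z : forall k, pz p k.+1 = lazy W (y k ^+ 7) *m pz p k + y k ^+ 7 *: pez p k
    + (ca * y k ^+ 9) *: pg p k;
  path_x : forall k, px p k.+1 = lazy W (y k ^+ 7) *m px p k + y k ^+ 7 *: pex p k
    - (pz p k.+1 - pz p k);
  path_Nx0 : pNx p 0 = 0; path_Nz0 : pNz p 0 = 0; path_xi0 : pxi p 0 = 0;
  path_Nx : forall k, pNx p k.+1 =
    lazy W (y k ^+ 7) *m pNx p k + y k ^+ 7 *: (dev r *m pex p k);
  path_Nz : forall k, pNz p k.+1 =
    lazy W (y k ^+ 7) *m pNz p k + y k ^+ 7 *: (dev r *m pez p k);
  path_xi : forall k, pxi p k.+1 = (1 - ca * mu * y k ^+ 9) * pxi p k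
    + y k ^+ 7 * (wavg r (pex p k) - wavg r (pez p k));
  path_k : forall k i, `|pk p k i 0 - (n%:R * r i 0)^-1| <= Ck * y k ^+ 3 }.

Definition pZ (p : path) k := dev r *m pz p k - pNz p k.
(* The increment z' - z in the x-update cancels in x + z, so that U is driven by
   (I - W) z only. *)
Definition pU (p : path) k := dev r *m px p k + dev r *m pz p k - pNx p k.
Definition pu (p : path) k := wavg r (px p k) - xs - pxi p k.
Definition pS (p : path) k :=
  qf A (pU p k) + qf A (pZ p k) + (qf A (pNx p k) + qf A (pNz p k)).

Lemma pS_ge0 p k : 0 <= pS p k.
Proof. by rewrite !addr_ge0 ?qf_ge0. Qed.

(** Subtracting [dev z = Z + N^z] from [dev (x + z) = U + N^x] recovers [dev x]. *)
Lemma qf_dev_px p k : qf A (dev r *m px p k) <= 4 * pS p k.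
Proof.
have -> : dev r *m px p k = (pU p k - pZ p k) + (pNx p k - pNz p k).
  rewrite /pU /pZ; set a := dev r *m px p k; set b := dev r *m pz p k.
  by apply/matrixP => i j; rewrite !mxE; ring.
have := qfD2 A (pU p k - pZ p k) (pNx p k - pNz p k).
have := qfD2 A (pU p k) (- pZ p k); have := qfD2 A (pNx p k) (- pNz p k).
rewrite !qfN /pS; lra.
Qed.

Lemma qf_dev_pz p k : qf A (dev r *m pz p k) <= 2 * (qf A (pZ p k) + qf A (pNz p k)).
Proof. by rewrite -[dev r *m _](subrK (pNz p k)); exact: qfD2. Qed.

Lemma px_decomp p k i :
  px p k i 0 - xs = pu p k + pxi p k + (dev r *m px p k) i 0.
Proof.
rewrite -dev_wavg /pu; set a := wavg _ _; rewrite !mxE mulr1; ring.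
Qed.

Lemma dev_entry p k i : (dev r *m px p k) i 0 ^+ 2 <= 4 * pS p k.
Proof. exact: le_trans (entry_sqr_le_qf _ _ scale) (qf_dev_px p k). Qed.

Lemma sqr_add3 (a b c : R) : (a + b + c) ^+ 2 <= 3 * (a ^+ 2 + b ^+ 2 + c ^+ 2).
Proof.
have := sqr_ge0 (a - b); have := sqr_ge0 (a - c); have := sqr_ge0 (b - c); nra.
Qed.

(** Controls the squared local gradients up to a constant; the summand 1 accounts for the gradients
    at [xs], which vanish only on average. *)
Definition pM (p : path) k := 1 + pu p k ^+ 2 + pxi p k ^+ 2 + pS p k.

Lemma pM_ge1 p k : 1 <= pM p k.
Proof.
rewrite /pM -!addrA lerDl; apply: addr_ge0; first exact: sqr_ge0.
by apply: addr_ge0; [exact: sqr_ge0 | exact: pS_ge0].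
Qed.

Lemma sqr_lipschitz i u v : (derive1 (f i) u - derive1 (f i) v) ^+ 2 <= L ^+ 2 * (u - v) ^+ 2.
Proof.
rewrite -exprMn -[leLHS]real_normK ?num_real// -[leRHS]real_normK ?num_real//.
rewrite lerXn2r ?nnegrE// normrM (gtr0_norm L0); exact: (hs i).2.
Qed.

Lemma grad_bound : exists2 C, 0 <= C &
  forall p k i, derive1 (f i) (px p k i 0) ^+ 2 <= C * pM p k.
Proof.
pose C0 := \sum_i derive1 (f i) xs ^+ 2.
have C00 : 0 <= C0 by rewrite sumr_ge0// => i _; rewrite sqr_ge0.
exists (2 * C0 + 24 * L ^+ 2) => [|p k i].
  by apply: addr_ge0; apply: mulr_ge0; rewrite ?sqr_ge0.
have h1 : derive1 (f i) xs ^+ 2 <= C0.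
  by rewrite /C0 (bigD1 i)//= lerDl sumr_ge0// => l _; rewrite sqr_ge0.
have h2 := sqr_lipschitz i (px p k i 0) xs.
have h3 := sqr_add3 (pu p k) (pxi p k) ((dev r *m px p k) i 0).
have h4 := dev_entry p k i; rewrite px_decomp in h2.
set a := derive1 (f i) (px p k i 0) in h2 *; set b := derive1 (f i) xs in h1 h2.
set D := _ i 0 in h2 h3 h4; have S0 := pS_ge0 p k.
have U0 := sqr_ge0 (pu p k); have X0 := sqr_ge0 (pxi p k).
have h5 : (pu p k + pxi p k + D) ^+ 2 <= 12 * (pu p k ^+ 2 + pxi p k ^+ 2 + pS p k).
  by move: h3 h4 U0 X0; lra.
have h6 := ler_wpM2l (sqr_ge0 L) h5.
have h7 : a ^+ 2 <= 2 * b ^+ 2 + 2 * (a - b) ^+ 2.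
  by have := sqr_ge0 (a - 2 * b); nra.
have h8 : C0 <= C0 * pM p k.
  by rewrite ler_peMr// pM_ge1.
rewrite mulrDl.
have h9 : L ^+ 2 * (12 * (pu p k ^+ 2 + pxi p k ^+ 2 + pS p k)) <= 12 * L ^+ 2 * pM p k.
  rewrite mulrCA mulrA; apply: ler_wpM2l.
    by apply: mulr_ge0; rewrite ?sqr_ge0.
  by rewrite /pM -!addrA lerDr.
by move: h1 h2 h6 h7 h8 h9; lra.
Qed.

Lemma kappa_sqr : exists2 C, 0 <= C & forall p, is_path p -> forall k i, pk p k i 0 ^+ 2 <= C.
Proof.
pose C0 := \sum_i (n%:R * r i 0)^-1.
have pos i : 0 <= (n%:R * r i 0)^-1 by rewrite invr_ge0 mulr_ge0// ltW.
exists ((Ck + C0) ^+ 2) => [|p hp k i]; first exact: sqr_ge0.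
have C00 : 0 <= C0 by rewrite sumr_ge0.
rewrite -[leLHS]real_normK ?num_real// lerXn2r ?nnegrE ?addr_ge0//.
rewrite -[pk _ _ _ _](subrK (n%:R * r i 0)^-1); apply: (le_trans (ler_normD _ _)).
apply: lerD.
  by apply: (le_trans (path_k hp k i)); rewrite ler_piMr// decayX_le1.
by rewrite ger0_norm// /C0 (bigD1 i)//= lerDl sumr_ge0.
Qed.

Lemma qf_dev_pg : exists2 C, 0 <= C & forall p, is_path p -> forall k,
  qf A (dev r *m pg p k) <= C * pM p k.
Proof.
have [Cg Cg0 HCg] := grad_bound; have [Cp Cp0 HCp] := kappa_sqr.
have [C1 C10 HC1] := qf_bound (A *m dev r).
exists (C1 * (n%:R * (Cp * Cg))) => [|p hp k]; first by rewrite !mulr_ge0.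
apply: (@le_trans _ _ (C1 * \sum_i pg p k i 0 ^+ 2)).
  by have := HC1 (pg p k); rewrite /qf -mulmxA.
rewrite -!mulrA ler_wpM2l// mulr_natl -[X in _ *+ X]card_ord -sumr_const.
apply: ler_sum => i _; rewrite mxE exprMn; apply: ler_pM; rewrite ?sqr_ge0//.
exact: HCp.
Qed.

(** Keeps the filters, and with them [pZ] and [pU], in the subspace where the lazy matrices
    contract. *)
Lemma trmx_pN p k : is_path p -> r^T *m pNx p k = 0 /\ r^T *m pNz p k = 0.
Proof.
move=> hp; elim: k => [|k [IHx IHz]].
  by rewrite (path_Nx0 hp) (path_Nz0 hp) mulmx0.
rewrite (path_Nx hp) (path_Nz hp) !mulmxDr !trmx_lazy// IHx IHz.
by rewrite -!scalemxAr !mulmxA trmx_dev// !mul0mx scaler0 addr0.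
Qed.

Lemma trmx_pZ p k : is_path p -> r^T *m pZ p k = 0.
Proof.
by move=> /(trmx_pN k)[_ h]; rewrite mulmxBr h mulmxA trmx_dev// mul0mx subrr.
Qed.

Lemma trmx_pU p k : is_path p -> r^T *m pU p k = 0.
Proof.
move=> /(trmx_pN k)[h _].
by rewrite mulmxBr mulmxDr h !mulmxA trmx_dev// !mul0mx addr0 subrr.
Qed.

Lemma rho_coef_ge0 : 0 <= 1 + 2 / rho.
Proof. by rewrite addr_ge0// divr_ge0// ltW. Qed.

Lemma decay7_01 k : 0 < y k ^+ 7 <= 1.
Proof. by rewrite decayX_gt0 decayX_le1. Qed.

(** Writing [alpha = beta (ca y^2)], the gradient is an input of size [y^2] at gain [beta = y^7];
    squared, it contributes [y^7 y^4]. *)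
Lemma pZ_rec : exists2 C, 0 <= C & forall p, is_path p -> forall k,
  qf A (pZ p k.+1) <= (1 - rho / 2 * y k ^+ 7) * qf A (pZ p k) + C * y k ^+ 11 * pM p k.
Proof.
have [Cg Cg0 HCg] := qf_dev_pg.
exists ((1 + 2 / rho) * (ca ^+ 2 * Cg)) => [|p hp k].
  by apply: mulr_ge0 rho_coef_ge0 _; apply: mulr_ge0; rewrite ?sqr_ge0.
have E : pZ p k.+1 = lazy W (y k ^+ 7) *m pZ p k
    + y k ^+ 7 *: ((ca * y k ^+ 2) *: (dev r *m pg p k)).
  rewrite /pZ (path_z hp) (path_Nz hp) mulmxBr lazy_dev// !mulmxDr -!scalemxAr scalerA.
  rewrite (_ : y k ^+ 7 * (ca * y k ^+ 2) = ca * y k ^+ 9); last by ring.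
  set a := dev r *m (lazy _ _ *m _); set b := lazy _ _ *m _.
  by apply/matrixP => i j; rewrite !mxE; ring.
rewrite E; apply: (le_trans (qf_lazy_step rho_gt0 contr _ (decay7_01 k) (trmx_pZ k hp))).
rewrite (_ : 1 - y k ^+ 7 * rho / 2 = 1 - rho / 2 * y k ^+ 7); last by ring.
rewrite lerD2l qfZ.
apply: (@le_trans _ _ (y k ^+ 7 * (1 + 2 / rho) * ((ca * y k ^+ 2) ^+ 2 * (Cg * pM p k)))).
  apply: ler_wpM2l; last by apply: ler_wpM2l; rewrite ?sqr_ge0 ?HCg.
  by apply: mulr_ge0 rho_coef_ge0; exact: decayX_ge0.
by rewrite le_eqVlt; apply/orP; left; apply/eqP; ring.
Qed.

(** The old [dev z] left after cancellation is [lazy (dev z) + beta (I - W) (dev z)]; its second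
    part is the only forcing. *)
Lemma pU_rec : exists2 C, 0 <= C & forall p, is_path p -> forall k,
  qf A (pU p k.+1) <= (1 - rho / 2 * y k ^+ 7) * qf A (pU p k)
    + C * y k ^+ 7 * (qf A (pZ p k) + qf A (pNz p k)).
Proof.
have [C1 C10 HC1] := qf_bound (A *m (1%:M - W)).
exists ((1 + 2 / rho) * (C1 * 2)) => [|p hp k].
  by apply: mulr_ge0 rho_coef_ge0 _; apply: mulr_ge0.
have E : pU p k.+1 = lazy W (y k ^+ 7) *m pU p k
    + y k ^+ 7 *: ((1%:M - W) *m (dev r *m pz p k)).
  have E1 : dev r *m px p k.+1 = dev r *m (lazy W (y k ^+ 7) *m px p k)
      + y k ^+ 7 *: (dev r *m pex p k) - (dev r *m pz p k.+1 - dev r *m pz p k).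
    by rewrite (path_x hp) [LHS]mulmxBr mulmxDr -scalemxAr (mulmxBr _ (pz p k.+1)).
  rewrite /pU E1 (path_Nx hp) [lazy W _ *m (_ - _)]mulmxBr [lazy W _ *m (_ + _)]mulmxDr.
  rewrite (lazy_dev W1 rW _ (px p k)) (lazyE W _ (dev r *m pz p k)) (mulmxBl 1%:M W) mul1mx.
  set a := dev r *m (lazy _ _ *m _); set b := lazy _ _ *m _; set c := W *m _.
  set d := dev r *m pz p k.+1; set e := dev r *m pz p k; set g := dev r *m pex p k.
  by apply/matrixP => i j; rewrite !mxE; ring.
rewrite E; apply: (le_trans (qf_lazy_step rho_gt0 contr _ (decay7_01 k) (trmx_pU k hp))).
rewrite (_ : 1 - y k ^+ 7 * rho / 2 = 1 - rho / 2 * y k ^+ 7); last by ring.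
rewrite lerD2l.
apply: (@le_trans _ _ (y k ^+ 7 * (1 + 2 / rho) *
    (C1 * (2 * (qf A (pZ p k) + qf A (pNz p k)))))); last first.
  by rewrite le_eqVlt; apply/orP; left; apply/eqP; ring.
apply: ler_wpM2l.
  by apply: mulr_ge0 rho_coef_ge0; exact: decayX_ge0.
apply: (@le_trans _ _ (C1 * qf A (dev r *m pz p k))).
  apply: (@le_trans _ _ (C1 * \sum_i (dev r *m pz p k) i 0 ^+ 2)).
    by have := HC1 (dev r *m pz p k); rewrite /qf -mulmxA.
  by rewrite ler_wpM2l.
by rewrite ler_wpM2l// qf_dev_pz.
Qed.

Lemma r_le1 i : r i 0 <= 1.
Proof. by rewrite -r1 (bigD1 i)//= lerDl sumr_ge0// => j _; exact: ltW. Qed.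

(** The limit [1 / (n r_i)] of kappa undoes the weights [r_i], so [u] makes an exact gradient step
    for the average up to [a E]. The noise cancels against that in [xi]. *)
Lemma pu_rec : exists2 C, 0 <= C & forall p, is_path p -> forall k,
  pu p k.+1 ^+ 2 <= (1 - ca * mu * y k ^+ 9) * pu p k ^+ 2
    + C * y k ^+ 9 * (pxi p k ^+ 2 + pS p k + y k ^+ 6 * (1 + pu p k ^+ 2)).
Proof.
have [Cg Cg0 HCg] := grad_bound.
pose C2 := n%:R * (n%:R * (Ck ^+ 2 * Cg)).
have C20 : 0 <= C2.
  by apply: mulr_ge0 => //; apply: mulr_ge0 => //; apply: mulr_ge0 => //; exact: sqr_ge0.
pose C3 := 3 * (8 * L ^+ 2 + C2 + mu ^+ 2).
have C30 : 0 <= C3.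
  apply: mulr_ge0 => //; apply: addr_ge0; last exact: sqr_ge0.
  by apply: addr_ge0 => //; apply: mulr_ge0 => //; exact: sqr_ge0.
exists (ca / mu * C3) => [|p hp k].
  by rewrite mulr_ge0// divr_ge0// ltW.
set a := ca * y k ^+ 9.
have a0 : 0 < a by rewrite mulr_gt0 ?decayX_gt0.
have aca : a <= ca by rewrite ler_piMr ?(ltW ca0)// decayX_le1.
have aL : a * (L + mu) <= 1.
  by apply: le_trans caL; rewrite ler_wpM2r// addr_ge0 ?(ltW L0) ?(ltW mu0).
have am : a * mu < 1.
  by apply: lt_le_trans aL; rewrite ltr_pM2l// ltrDr.
set u := pu p k; set xi := pxi p k; set S := pS p k.
pose dl i := pk p k i 0 - (n%:R * r i 0)^-1.
pose g i := derive1 (f i) (px p k i 0).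
pose T1 := n%:R^-1 * \sum_i (derive1 (f i) (xs + u) - g i).
pose T2 := \sum_i r i 0 * dl i * - g i.
(* [T1] comes from evaluating gradients at [x_i] instead of [xs + u], [T2] from the error of kappa,
   and [mu * xi] from the damping built into [xi]. *)
pose E := T1 + T2 + mu * xi.
have nR : 0 < n%:R :> R by rewrite ltr0n.
have step : pu p k.+1 = (u - a * avg_grad f (xs + u)) + a * E.
  have wz : wavg r (pz p k.+1 - pz p k) = y k ^+ 7 * wavg r (pez p k) + a * wavg r (pg p k).
    rewrite /wavg (path_z hp) mulmxBr !mulmxDr trmx_lazy// -!scalemxAr.
    set b := r^T *m pz p k; set c := r^T *m pez p k; set d := r^T *m pg p k.
    by rewrite !mxE -/a; ring.
  have wx : wavg r (px p k.+1) = wavg r (px p k) + y k ^+ 7 * wavg r (pex p k)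
     - wavg r (pz p k.+1 - pz p k).
    rewrite (path_x hp); set d := pz p k.+1 - pz p k; rewrite /wavg.
    rewrite mulmxBr mulmxDr trmx_lazy// -scalemxAr.
    set b := r^T *m px p k; set c := r^T *m pex p k; set e := r^T *m d.
    by rewrite !mxE.
  have wg : wavg r (pg p k) = avg_grad f (xs + u) - T1 - T2.
    rewrite /wavg mxE /T1 /T2 /avg_grad -mulrBr -!sumrB mulr_sumr -sumrB.
    apply: eq_bigr => i _; rewrite !mxE -/(g i) /dl.
    by field; rewrite (gt_eqF nR) gt_eqF.
  rewrite /pu wx wz wg (path_xi hp) -/a /E /u /pu -/xi /a; ring.
have hT1 : T1 ^+ 2 <= 8 * L ^+ 2 * (xi ^+ 2 + S).
  rewrite /T1 exprMn.
  apply: (@le_trans _ _ (n%:R^-1 ^+ 2 *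
      (n%:R * \sum_i (derive1 (f i) (xs + u) - g i) ^+ 2))).
    rewrite ler_wpM2l ?sqr_ge0//; apply: (le_trans (sqr_sum_le _)).
    by rewrite card_ord.
  rewrite mulrA (_ : n%:R^-1 ^+ 2 * n%:R = n%:R^-1); last by field; rewrite gt_eqF.
  rewrite -[leRHS](avg_const n_gt0); apply: avg_le => i.
  apply: (le_trans (sqr_lipschitz i _ _)).
  rewrite (_ : 8 * L ^+ 2 * _ = L ^+ 2 * (8 * (xi ^+ 2 + S))); last by ring.
  rewrite ler_wpM2l ?sqr_ge0//.
  have h := px_decomp p k i; have hD := dev_entry p k i; rewrite -/S in hD.
  set D := (dev r *m px p k) i 0 in h hD.
  have -> : xs + u - px p k i 0 = - (xi + D).
    by rewrite -[px p k i 0](subrK xs) h -/u -/xi; ring.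
  by have := sqr_ge0 (xi - D); have := sqr_ge0 xi; nra.
have hT2 : T2 ^+ 2 <= C2 * (y k ^+ 6 * pM p k).
  rewrite /T2; apply: (le_trans (sqr_sum_le _)); rewrite card_ord /C2 -mulrA ler_wpM2l//.
  rewrite -mulrA mulr_natl -[X in _ *+ X]card_ord -sumr_const; apply: ler_sum => i _.
  rewrite mulrN sqrrN exprMn.
  rewrite (_ : Ck ^+ 2 * Cg * _ = (Ck * y k ^+ 3) ^+ 2 * (Cg * pM p k)); last by ring.
  apply: ler_pM; rewrite ?sqr_ge0// ?HCg//.
  rewrite exprMn -[leRHS]mul1r; apply: ler_pM; rewrite ?sqr_ge0//.
    by rewrite exprn_ile1 ?r_le1 ?ltW.
  have pos : 0 <= Ck * y k ^+ 3 by apply: mulr_ge0; rewrite ?decayX_ge0.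
  by rewrite -[leLHS]real_normK ?num_real// lerXn2r ?nnegrE//; exact: (path_k hp k i).
have hE : E ^+ 2 <= C3 * (xi ^+ 2 + S + y k ^+ 6 * (1 + u ^+ 2)).
  apply: (le_trans (sqr_add3 _ _ _)).
  have S0 : 0 <= S := pS_ge0 p k; have X0 := sqr_ge0 xi; have U0 := sqr_ge0 u.
  have y60 := decayX_ge0 R k 6; have y61 := decayX_le1 R k 6.
  set Q := xi ^+ 2 + S + y k ^+ 6 * (1 + u ^+ 2).
  have Y0 : 0 <= y k ^+ 6 * (1 + u ^+ 2) by rewrite mulr_ge0// addr_ge0.
  have q1 : xi ^+ 2 + S <= Q by rewrite lerDl.
  have q2 : xi ^+ 2 <= Q by rewrite /Q; lra.
  have q3 : y k ^+ 6 * pM p k <= Q.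
    rewrite /Q /pM -/u -/xi -/S.
    by have := ler_wpM2r (addr_ge0 X0 S0) y61; lra.
  have w1 := ler_wpM2l (mulr_ge0 (ler0n R 8) (sqr_ge0 L)) q1.
  have w2 := ler_wpM2l C20 q3; have w3 := ler_wpM2l (sqr_ge0 mu) q2.
  rewrite (exprMn _ mu); rewrite /C3; move: hT1 hT2 w1 w2 w3.
  set t1 := T1 ^+ 2; set t2 := T2 ^+ 2; set t3 := mu ^+ 2 * xi ^+ 2; lra.
have hp1 : (u - a * avg_grad f (xs + u)) ^+ 2 <= (1 - a * mu) ^+ 2 * u ^+ 2.
  by apply: (grad_step n_gt0 mu0 L0 hc hs hxs) => //; exact: ltW.
rewrite step; apply: (le_trans (perturbed_step E a0 mu0 am hp1)).
rewrite (_ : a * mu = ca * mu * y k ^+ 9); last by rewrite /a; ring.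
rewrite lerD2l.
apply: (@le_trans _ _ (a / mu * (C3 * (xi ^+ 2 + S + y k ^+ 6 * (1 + u ^+ 2))))).
  by rewrite ler_wpM2l// divr_ge0// ltW.
by rewrite le_eqVlt; apply/orP; left; apply/eqP; rewrite /a; ring.
Qed.

End Path.

(** * Rates *)

Section Bootstrap.
Context d (T : measurableType d) (R : realType) (P : probability T R).
Variable Om : set T.
Local Notation y := (@decay R).
Local Notation dominated := (dominated P Om).
Variables (V1 V2 V3 X Nx Nz : nat -> T -> R) (c h C1 C2 C3 v1 v2 v3 : R).
Hypotheses (c01 : 0 < c <= 1) (h01 : 0 < h <= 1).
Hypotheses (C10 : 0 <= C1) (C20 : 0 <= C2) (C30 : 0 <= C3).
Hypotheses (V1_ge0 : forall k w, 0 <= V1 k w) (V2_ge0 : forall k w, 0 <= V2 k w)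
  (V3_ge0 : forall k w, 0 <= V3 k w).
Hypotheses (X_dom : dominated X 5) (Nx_dom : dominated Nx 7) (Nz_dom : dominated Nz 7).
Hypotheses (V1_init : forall w, V1 0%N w <= v1) (V2_init : forall w, V2 0%N w <= v2)
  (V3_init : forall w, V3 0%N w <= v3).
Hypothesis V1_rec : forall k w, Om w -> V1 k.+1 w <= (1 - c * y k ^+ 9) * V1 k w
  + C1 * y k ^+ 9 * (X k w + (V2 k w + V3 k w + (Nx k w + Nz k w))
                     + y k ^+ 6 * (1 + V1 k w)).
Hypothesis V2_rec : forall k w, Om w -> V2 k.+1 w <= (1 - h * y k ^+ 7) * V2 k w
  + C2 * y k ^+ 7 * (V3 k w + Nz k w).
Hypothesis V3_rec : forall k w, Om w -> V3 k.+1 w <= (1 - h * y k ^+ 7) * V3 k w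
  + C3 * y k ^+ 11 * (1 + V1 k w + X k w + (V2 k w + V3 k w + (Nx k w + Nz k w))).

Lemma dominated_const t : dominated (fun k _ => y k ^+ t) t.
Proof.
by apply: dominated_le (dominated_decay P Om t ler01) => k w _; rewrite mul1r.
Qed.

(** [V1], [V2], [V3] stand for [u^2], [|U|^2], [|Z|^2], and [X], [Nx], [Nz] for the squared filters.
    [V3] feeds [V2] at the full gain [y^7], hence its weight [K]. The sum contracts only like the
    slowest component, [y^9], and with forcing of order [y^9] it stays bounded. *)
Lemma lyapunov_dominated : dominated V1 0 /\ dominated V2 0 /\ dominated V3 0.
Proof.
have [[c0 c1] [h0 h1]] := (andP c01, andP h01).
(* K is large enough for the contraction of V3 to absorb its contribution to V2;
   C' absorbs the terms of order y^9 by AM-GM between y^7 and y^11. *)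
pose K := 2 * C2 / h + 1.
pose E := C1 + c.
pose C' := C1 + K * C3 + E ^+ 2 / h.
have K1 : 1 <= K by rewrite lerDr divr_ge0 ?mulr_ge0// ltW.
have K0 : 0 <= K := le_trans ler01 K1.
have Kh : C2 <= K * h / 2.
  rewrite /K (_ : _ * h / 2 = C2 + h / 2); last by field; rewrite gt_eqF.
  by rewrite lerDl divr_ge0// ltW.
have KC3 : 0 <= K * C3 by rewrite mulr_ge0.
have E0 : 0 <= E by rewrite addr_ge0// ltW.
have Eh : 0 <= E ^+ 2 / h by rewrite divr_ge0 ?sqr_ge0// ltW.
have C'0 : 0 <= C' by rewrite !addr_ge0.
pose a k := 1 - c * y k ^+ 9 + C' * y k ^+ 11.
pose F k w := C1 * y k ^+ 9 * (X k w + (Nx k w + Nz k w) + y k ^+ 6)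
  + C2 * y k ^+ 7 * Nz k w + K * C3 * y k ^+ 11 * (1 + X k w + (Nx k w + Nz k w)).
pose V k w := V1 k w + V2 k w + K * V3 k w.
have [N HN] : exists N, forall k, (N <= k)%N -> C' * y k ^+ 2 <= c / 2.
  have e0 : 0 < c / 2 / (C' + 1) by rewrite !divr_gt0// ltr_wpDl.
  have [N H] := decay_small e0; exists N => k /H; rewrite ler_pdivlMr ?ltr_wpDl// => le_c.
  apply: le_trans le_c; rewrite mulrC; apply: ler_pM; rewrite ?decayX_ge0//.
    by rewrite -[leRHS]expr1 decayX_le.
  by rewrite lerDl.
have Vdom : dominated V 0.
  apply: (@dominated_chung _ _ _ _ _ V F a (c / 2) (v1 + v2 + K * v3) 9 0 N) => //.
  - by rewrite divr_gt0.
  - move=> k; apply: addr_ge0; last by apply: mulr_ge0; rewrite ?decayX_ge0.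
    by rewrite subr_ge0 mulr_ile1 ?decayX_ge0 ?decayX_le1// ltW.
  - move=> k /HN le_c; have := ler_wpM2l (decayX_ge0 R k 9) le_c.
    rewrite /a (_ : y k ^+ 9 * (C' * y k ^+ 2) = C' * y k ^+ 11); last by ring.
    lra.
  - rewrite addn0.
    have N5 : dominated (fun k w => X k w + (Nx k w + Nz k w)) 5.
      apply: dominated_add => //; apply: dominated_add; exact: (dominated_weaken (isT : (5 <= 7)%N)).
    have F1 := dominated_decayM 9 C10 (dominated_add N5 (dominated_weaken (isT : (5 <= 6)%N) (dominated_const 6))).
    have F2 := dominated_decayM 7 C20 Nz_dom.
    have F3 := dominated_decayM 11 KC3 (dominated_add (dominated_const 0) (dominated_weaken (isT : (0 <= 5)%N) N5)).
    have F12 := dominated_add (dominated_weaken (isT : (9 <= 9 + 5)%N) F1)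
      (dominated_weaken (isT : (9 <= 7 + 7)%N) F2).
    apply: dominated_le (dominated_add F12 (dominated_weaken (isT : (9 <= 11 + 0)%N) F3)).
    by move=> k w _; rewrite /F expr0 [1 + (X k w + _)]addrA.
  - by move=> w _; rewrite lerD// ?lerD// ler_wpM2l.
  move=> k w Ow.
  have r1 := V1_rec k Ow; have r2 := V2_rec k Ow; have r3 := ler_wpM2l K0 (V3_rec k Ow).
  have g1 := V1_ge0 k w; have g2 := V2_ge0 k w; have g3 := V3_ge0 k w.
  apply: (le_trans (lerD (lerD r1 r2) r3)).
  rewrite /V /F.
  set U1 := V1 k w in g1 *; set U2 := V2 k w in g2 *; set U3 := V3 k w in g3 *.
  pose s := y k ^+ 2.
  have s0 : 0 <= s by exact: decayX_ge0.
  have y70 := decayX_ge0 R k 7; have y110 := decayX_ge0 R k 11.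
  have e9 : y k ^+ 9 = y k ^+ 7 * s by rewrite /s; ring.
  have e11 : y k ^+ 11 = y k ^+ 7 * s ^+ 2 by rewrite /s; ring.
  have e15 : y k ^+ 9 * y k ^+ 6 <= y k ^+ 11 by rewrite -exprD decayX_le.
  have quad : 0 <= h / 2 - E * s + E ^+ 2 / h * s ^+ 2.
    have -> : h / 2 - E * s + E ^+ 2 / h * s ^+ 2 =
        ((E * s - h / 2) ^+ 2 + h ^+ 2 / 4) / h by field; rewrite gt_eqF.
    by rewrite divr_ge0 ?(ltW h0)// addr_ge0 ?sqr_ge0// divr_ge0 ?sqr_ge0.
  (* [k1], [k2], [k3] compare the total coefficients of [V1], [V2], [V3] with [a k], [a k],
     [K * a k]. In the last two, [quad] trades the surplus [h y^7 / 2] and a term in [y^11] for the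
     terms in [y^9]. *)
  have k1 : 1 - c * y k ^+ 9 + C1 * (y k ^+ 9 * y k ^+ 6) + K * C3 * y k ^+ 11 <= a k.
    rewrite -subr_ge0 /a /C'.
    set p := y k ^+ 9 * y k ^+ 6 in e15 *; set q := y k ^+ 11 in e15 y110 *.
    have -> : 1 - c * y k ^+ 9 + (C1 + K * C3 + E ^+ 2 / h) * q -
      (1 - c * y k ^+ 9 + C1 * p + K * C3 * q) = C1 * (q - p) + E ^+ 2 / h * q by ring.
    by apply: addr_ge0; apply: mulr_ge0 => //; rewrite subr_ge0.
  have k2 : 1 - h * y k ^+ 7 + C1 * y k ^+ 9 + K * C3 * y k ^+ 11 <= a k.
    rewrite -subr_ge0 /a /C' e9 e11.
    have -> : 1 - c * (y k ^+ 7 * s) + (C1 + K * C3 + E ^+ 2 / h) * (y k ^+ 7 * s ^+ 2)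
      - (1 - h * y k ^+ 7 + C1 * (y k ^+ 7 * s) + K * C3 * (y k ^+ 7 * s ^+ 2)) =
      y k ^+ 7 * ((h / 2 - E * s + E ^+ 2 / h * s ^+ 2) + (h / 2 + C1 * s ^+ 2)).
      by rewrite /E; field; rewrite gt_eqF.
    apply: mulr_ge0 => //; apply: addr_ge0 => //; apply: addr_ge0.
      by rewrite divr_ge0// ltW.
    by apply: mulr_ge0; rewrite ?sqr_ge0.
  have k3 : K * (1 - h * y k ^+ 7) + C2 * y k ^+ 7 + C1 * y k ^+ 9 + K * C3 * y k ^+ 11 <= K * a k.
    have b1 : C2 * y k ^+ 7 <= K * h / 2 * y k ^+ 7 by rewrite ler_wpM2r.
    have b2 : C1 * y k ^+ 9 <= K * (C1 * y k ^+ 9).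
      by rewrite ler_peMl//; apply: mulr_ge0; rewrite ?decayX_ge0.
    have b3 : 0 <= K * (y k ^+ 7 * (h / 2 - E * s + E ^+ 2 / h * s ^+ 2)).
      by apply: mulr_ge0 => //; exact: mulr_ge0.
    have b4 : 0 <= K * (y k ^+ 11 * (C1 + (K - 1) * C3)).
      apply: mulr_ge0 => //; apply: mulr_ge0 => //; apply: addr_ge0 => //.
      by apply: mulr_ge0 => //; rewrite subr_ge0.
    rewrite -subr_ge0; rewrite -subr_ge0 in b1; rewrite -subr_ge0 in b2.
    apply: (le_trans (addr_ge0 (addr_ge0 b1 b2) (addr_ge0 b3 b4))).
    rewrite le_eqVlt; apply/orP; left; apply/eqP; rewrite /a /C' e9 e11 /E.
    by field; rewrite gt_eqF.
  have m1 := ler_wpM2r g1 k1; have m2 := ler_wpM2r g2 k2; have m3 := ler_wpM2r g3 k3.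
  rewrite -subr_ge0 in m1; rewrite -subr_ge0 in m2; rewrite -subr_ge0 in m3.
  rewrite -subr_ge0; apply: (le_trans (addr_ge0 (addr_ge0 m1 m2) m3)).
  by rewrite le_eqVlt; apply/orP; left; apply/eqP; ring.
have KV3 k w : 0 <= K * V3 k w by rewrite mulr_ge0.
split; [|split]; apply: dominated_le Vdom => k w _; rewrite /V.
- by rewrite -addrA lerDl addr_ge0.
- by rewrite -addrA addrCA lerDl addr_ge0.
- by apply: (@le_trans _ _ (K * V3 k w)); [rewrite ler_peMl | rewrite lerDr addr_ge0].
Qed.

(** Bounded terms enter at gain [y^11 = y^(7+4)] against the contraction [y^7]; this exponent 4
    limits the final rate. *)
Lemma V3_dominated : dominated V3 4.
Proof.
have [[c0 c1] [h0 h1]] := (andP c01, andP h01).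
have [D1 [D2 D3]] := lyapunov_dominated.
have D : dominated (fun k w => 1 + V1 k w + X k w + (V2 k w + V3 k w + (Nx k w + Nz k w))) 0.
  apply: dominated_add; apply: dominated_add.
  - by apply: dominated_add => //; exact: (dominated_le _ (dominated_const 0)).
  - exact: dominated_weaken X_dom.
  - exact: dominated_add.
  - by apply: dominated_add; [exact: dominated_weaken Nx_dom | exact: dominated_weaken Nz_dom].
apply: (@dominated_chung _ _ _ _ _ V3 _ _ h v3 7 4 0 h0 isT _ _ (dominated_decayM 11 C30 D)) V3_rec => //.
by move=> k; rewrite subr_ge0 mulr_ile1 ?decayX_ge0 ?decayX_le1// ltW.
Qed.

Lemma V2_dominated : dominated V2 4.
Proof.
have [[c0 c1] [h0 h1]] := (andP c01, andP h01).
have D : dominated (fun k w => V3 k w + Nz k w) 4.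
  by apply: dominated_add; [exact: V3_dominated | exact: dominated_weaken Nz_dom].
apply: (@dominated_chung _ _ _ _ _ V2 _ _ h v2 7 4 0 h0 isT _ _ (dominated_decayM 7 C20 D)) V2_rec => //.
by move=> k; rewrite subr_ge0 mulr_ile1 ?decayX_ge0 ?decayX_le1// ltW.
Qed.

(** Relative to the gain [y^9] the forcing has orders 5, 4, 4, 7, 7 and 6; the last one uses the
    boundedness of [V1]. *)
Lemma V1_dominated : dominated V1 4.
Proof.
have [[c0 c1] [h0 h1]] := (andP c01, andP h01).
have [D1 _] := lyapunov_dominated.
have D6 : dominated (fun k w => y k ^+ 6 * (1 + V1 k w)) 4.
  have D := dominated_decayM 6 ler01 (dominated_add (dominated_const 0) D1).
  apply: dominated_le (dominated_weaken (isT : (4 <= 6 + 0)%N) D) => k w _.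
  by rewrite mul1r expr0.
have D : dominated (fun k w => X k w + (V2 k w + V3 k w + (Nx k w + Nz k w))
                     + y k ^+ 6 * (1 + V1 k w)) 4.
  apply: dominated_add => //; apply: dominated_add; first exact: dominated_weaken X_dom.
  apply: dominated_add; apply: dominated_add.
  - exact: V2_dominated.
  - exact: V3_dominated.
  - exact: dominated_weaken Nx_dom.
  - exact: dominated_weaken Nz_dom.
apply: (@dominated_chung _ _ _ _ _ V1 _ _ c v1 9 4 0 c0 isT _ _ (dominated_decayM 9 C10 D)) V1_rec => //.
by move=> k; rewrite subr_ge0 mulr_ile1 ?decayX_ge0 ?decayX_le1// ltW.
Qed.

End Bootstrap.

(** * Second moments of the noise filters *)

Section NoiseFilter.
Context d (T : measurableType d) (R : realType) (P : probability T R).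
Variables (m n : nat) (Q : nat -> 'M[R]_m) (M : 'M[R]_(m, n)) (v : nat -> T -> 'cV[R]_n).
Hypothesis v_sqint : forall k i, sqint P (fun w => v k w i 0).
Hypothesis v_uncorrelated : forall k l i j, (l < k)%N ->
  uncorrelated P (fun w => v l w i 0) (fun w => v k w j 0).

Definition scaled_noise k w : 'cV[R]_m := decay R k ^+ 7 *: (M *m v k w).

Lemma scaled_noiseE k i : (fun w => scaled_noise k w i 0) =
  (fun w => \sum_j (decay R k ^+ 7 * M i j) * v k w j 0).
Proof.
apply/funext => w; rewrite !mxE mulr_sumr; apply: eq_bigr => j _; exact: mulrA.
Qed.

(** The input has second moment of order [beta^2 = y^14], hence [s + t = 14]. The disagreement
    filters contract with [s = 7], the scalar filter [xi] with [s = 9]. *)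
Lemma filtered_noise_dominated (Om : set T) (B : 'M[R]_m) (c sg : R) (s t : nat) :
  0 < c <= 1 -> (s <= 9)%N -> (s + t = 14)%N -> 0 <= sg ->
  (forall k w, qf B (Q k *m filtered Q scaled_noise k w) <=
     (1 - c * decay R k ^+ s) * qf B (filtered Q scaled_noise k w)) ->
  (forall k i, (\int[P]_w (v k w i 0 ^+ 2)%:E <= sg%:E)%E) ->
  dominated P Om (fun k w => qf B (filtered Q scaled_noise k w)) t.
Proof.
move=> c01 s9 st sg0 contr var.
have [C1 C10 HC1] := qf_bound (B *m M).
have zs k i : sqint P (fun w => scaled_noise k w i 0).
  by rewrite scaled_noiseE; exact: sqint_sum.
apply: (@filtered_dominated _ _ _ _ _ Q scaled_noise zs _ Om B c (C1 * (n%:R * sg)) s t) => //.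
- move=> k l i j lk; rewrite !scaled_noiseE.
  apply: uncorrelated_sum => [|i']; first exact: sqint_sum.
  by apply: uncorrelatedC; apply: uncorrelated_sum => // j'; apply/uncorrelatedC/v_uncorrelated.
- by rewrite !mulr_ge0.
move=> k; rewrite st.
have mv i : measurable_fun setT (fun w => v k w i 0 ^+ 2).
  by apply: measurable_sqr; have [] := v_sqint k i.
have C1y : 0 <= C1 * decay R k ^+ 14 by rewrite mulr_ge0 ?decayX_ge0.
apply: (@le_trans _ _ (\int[P]_w (C1 * decay R k ^+ 14 * \sum_i v k w i 0 ^+ 2)%:E)%E).
  apply: ge0_le_integral_nonmeasurable => w; rewrite lee_fin ?qf_ge0//.
  rewrite /scaled_noise qfZ -exprM mulrC mulrAC ler_wpM2r ?decayX_ge0//.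
  by have := HC1 (v k w); rewrite /qf -mulmxA.
rewrite integral_scale//; first last.
- by move=> w; rewrite sumr_ge0// => i _; exact: sqr_ge0.
- exact: measurable_sum.
under eq_integral do rewrite -sumEFin.
rewrite ge0_integral_sum//; first last.
- by move=> i w _; rewrite lee_fin sqr_ge0.
- by move=> i; exact/measurable_EFinP.
rewrite mulrAC [leRHS]EFinM; apply: lee_wpmul2l; first by rewrite lee_fin.
apply: (@le_trans _ _ (\sum_(i < n) sg%:E)%E); first exact: lee_sum.
by rewrite sumEFin sumr_const card_ord -[X in X%:E]mulr_natl.
Qed.

End NoiseFilter.

Lemma mutually_independent2 d (T : measurableType d) (R : realType)
    (P : probability T R) (I : eqType) (G : I -> set (set T)) (u v : I) (A B : set T) :
  mutually_independent P G -> u != v -> G u A -> G v B ->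
  (P (A `&` B) = P A * P B)%E.
Proof.
move=> hG uv GA GB; have vu : v == u = false by rewrite eq_sym; exact/negbTE.
have := hG [:: u; v] (fun i => if i == u then A else B).
rewrite /= inE uv => /(_ isT) H.
rewrite -(_ : \bigcap_(i in [set` [:: u; v]]) (if i == u then A else B) = A `&` B).
  rewrite H; last by move=> i; rewrite !inE => /orP[]/eqP ->; rewrite ?eqxx ?vu.
  by rewrite big_cons big_seq1 eqxx vu.
apply/seteqP; split => [w h|w [Aw Bw] i _]; last by case: ifP.
split; first by have := h u; rewrite /= inE eqxx; exact.
by have := h v; rewrite /= !inE eqxx orbT vu; exact.
Qed.

Lemma qf_scalar (R : realType) (v : 'cV[R]_1) : qf 1%:M v = v 0 0 ^+ 2.
Proof. by rewrite /qf big_ord1 mul1mx. Qed.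

Section Noise.
Context d (T : measurableType d) (R : realType) (P : probability T R).
Variables (n : nat) (sigma sigmay : R) (e : noise P n).
Hypotheses (sigma0 : 0 < sigma) (he : noise_assumption sigma sigmay e).

Definition noise_xz (b : bool) k i : {RV P >-> R} :=
  if b then noise_x e k i else noise_z e k i.

Lemma noise_xz_sqint b k i : sqint P (noise_xz b k i) /\
  (\int[P]_w (noise_xz b k i w ^+ 2)%:E <= sigma%:E)%E.
Proof.
case: b; apply: centered_sqint.
- exact: (noise_x_mean he).
- exact: (noise_x_var he).
- exact: (noise_z_mean he).
- exact: (noise_z_var he).
Qed.

(** Different times index different members of the independent family, whatever the agents and the
    kinds of noise. *)
Lemma noise_xz_uncorrelated b b' k l i j : l != k ->
  uncorrelated P (noise_xz b l i) (noise_xz b' k j).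
Proof.
move=> lk; apply: independent_uncorrelated; first last.
- by case: b; [exact: (noise_x_mean he) | exact: (noise_z_mean he)].
- exact: (noise_xz_sqint _ _ _).1.
- exact: (noise_xz_sqint _ _ _).1.
move=> A B mA mB.
pose idx (c : bool) m q : (nat * 'I_n) + (nat * 'I_n) + (nat * 'I_n) :=
  if c then inl (inl (m, q)) else inr (m, q).
have gen c m q D : measurable D -> noise_sigma e (idx c m q) (noise_xz c m q @^-1` D).
  by move=> mD; case: c => /=; exists D; rewrite ?setTI.
apply: (mutually_independent2 (noise_indep he) _ (gen b l i A mA) (gen b' k j B mB)).
by apply/eqP; case: b; case: b' => //= -[h _]; move: lk; rewrite h eqxx.
Qed.

Definition noise_vec (b : bool) k w : 'cV[R]_n := \col_i noise_xz b k i w.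

Lemma noise_vecE b k i : (fun w => noise_vec b k w i 0) = noise_xz b k i.
Proof. by apply/funext => w; rewrite mxE. Qed.

Definition noise_diff k w : 'cV[R]_n := noise_vec true k w - noise_vec false k w.

Lemma noise_diffE k i : (fun w => noise_diff k w i 0) =
  (fun w => -1 * noise_xz false k i w + noise_xz true k i w).
Proof. by apply/funext => w; rewrite !mxE mulN1r addrC. Qed.

Lemma noise_vec_sqint b k i : sqint P (fun w => noise_vec b k w i 0).
Proof. by rewrite noise_vecE; exact: (noise_xz_sqint _ _ _).1. Qed.

Lemma noise_vec_uncorrelated b k l i j : (l < k)%N ->
  uncorrelated P (fun w => noise_vec b l w i 0) (fun w => noise_vec b k w j 0).
Proof.
by move=> lk; rewrite !noise_vecE; apply: noise_xz_uncorrelated; rewrite neq_ltn lk.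
Qed.

Lemma noise_vec_var b k i : (\int[P]_w (noise_vec b k w i 0 ^+ 2)%:E <= sigma%:E)%E.
Proof.
by under eq_integral do rewrite mxE; exact: (noise_xz_sqint b k i).2.
Qed.

Lemma noise_diff_sqint k i : sqint P (fun w => noise_diff k w i 0).
Proof.
by rewrite noise_diffE; apply: sqint_affine; exact: (noise_xz_sqint _ _ _).1.
Qed.

Lemma noise_diff_uncorrelated k l i j : (l < k)%N ->
  uncorrelated P (fun w => noise_diff l w i 0) (fun w => noise_diff k w j 0).
Proof.
move=> lk; rewrite !noise_diffE.
have h b b' := @noise_xz_uncorrelated b b' k l i j (negbT (ltn_eqF lk)).
apply: uncorrelated_affine; apply: uncorrelatedC;
  by apply: uncorrelated_affine; apply: uncorrelatedC; exact: h.
Qed.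

Lemma noise_diff_var k i : (\int[P]_w (noise_diff k w i 0 ^+ 2)%:E <= (4 * sigma)%:E)%E.
Proof.
have [[m1 _] h1] := noise_xz_sqint true k i; have [[m2 _] h2] := noise_xz_sqint false k i.
apply: (@le_trans _ _ (\int[P]_w
    (2 * noise_xz true k i w ^+ 2 + 2 * noise_xz false k i w ^+ 2)%:E)%E).
  apply: ge0_le_integral_nonmeasurable => w; rewrite lee_fin ?sqr_ge0// !mxE.
  by have := sqr_ge0 (noise_xz true k i w + noise_xz false k i w); nra.
have s1 := measurable_sqr m1; have s2 := measurable_sqr m2.
rewrite integral_affine//; first last.
- by move=> w; apply: mulr_ge0; rewrite ?sqr_ge0.
- by move=> w; exact: sqr_ge0.
- exact: measurable_funM.
rewrite integral_scale//; last by move=> w; exact: sqr_ge0.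
rewrite (_ : 4 * sigma = 2 * sigma + 2 * sigma); last by ring.
by rewrite [leRHS]EFinD; apply: leeD; rewrite [leRHS]EFinM; apply: lee_wpmul2l; rewrite ?lee_fin.
Qed.

End Noise.

Lemma trmx_filtered d (T : measurableType d) (R : realType) (n : nat) (W : 'M[R]_n) (r : 'cV[R]_n)
    (b : nat -> R) (v : nat -> T -> 'cV[R]_n) k w :
  r^T *m W = r^T -> \sum_i r i 0 = 1 ->
  r^T *m filtered (fun k => lazy W (b k)) (scaled_noise (dev r) v) k w = 0.
Proof.
move=> rW r1; elim: k => [|k IH] /=; first exact: mulmx0.
rewrite mulmxDr trmx_lazy// IH /scaled_noise -scalemxAr mulmxA trmx_dev//.
by rewrite mul0mx scaler0 addr0.
Qed.

Theorem corollary1 (R : realType) (n : nat)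
  (N : rel 'I_n) (W : 'M[R]_n) (hW : network N W)
  (r : 'cV[R]_n) (hr : left_perron W r)
  (f : 'I_n -> R -> R) (mu L : R) (hmu : 0 < mu) (hL : 0 < L)
  (hconvex : forall i, strongly_convex mu (f i))
  (hsmooth : forall i, smooth L (f i))
  (xs : R) (hxs : minimizer (average f) xs)
  (epsk : R) (hepsk : 0 < epsk)
  (sigma sigmay : R) (hsigma : 0 < sigma) :
  exists2 eps0 : R, 0 < eps0 & forall eps : R, 0 < eps < eps0 ->
  exists cl cg ca cb p q a b : R,
    [/\ 0 < cl <= 1, 0 < cb <= 1, 0 < cg & 0 < ca] /\
    [/\ 0 < q, q < p & p < 1] /\
    [/\ 2^-1 < b, b < a & a < 1] /\
    [/\ 2 * p - 1 < a & 1 < 2 * a - b] /\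
    let g := Gains (poly_gain cl p) (poly_gain cg q)
                   (poly_gain ca a) (poly_gain cb b) in
    forall (A : 'M[R]_n) (rho : R), contractive_norm W r g A rho ->
    forall (d : measure_display) (T : measurableType d) (P : probability T R)
      (e : noise P n), noise_assumption sigma sigmay e ->
    forall x0 z0 : 'cV[R]_n,
    let x := fun k w => st_x (process W f epsk g x0 z0 e k w) in
    let z := fun k w => st_z (process W f epsk g x0 z0 e k w) in
    let rate := fun k : nat => k.+1%:R `^ (- (3^-1) + eps) in
    [/\ is_bigO (fun k => 'E_P[fun w =>
          (average f (wavg r (x k w)) - average f xs)%R]%E) rate,
        is_bigO (fun k => 'E_P[fun w =>
          (normA A (x k w - wavg r (x k w) *: ones R n) ^+ 2)%R]%E) rate
      & is_bigO (fun k => 'E_P[fun w =>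
          (normA A (z k w - wavg r (z k w) *: ones R n) ^+ 2)%R]%E) rate].
Proof.
exists 1 => // eps /andP[eps0 _].
have Lmu : 0 < L + mu by rewrite addr_gt0.
pose ca := (L + mu)^-1.
(* Exponents written in tenths match [poly_gain_decay], so that every gain becomes a natural power
   of [y]. *)
exists 1, 1, ca, 1, (5 / 10), (2 / 10), (9 / 10), (7 / 10).
split; first by rewrite !ltr01 !lexx /ca invr_gt0.
split; first by split; lra.
split; first by split; lra.
split; first by split; lra.
move=> g A rho hA d T P e he x0 z0 x z rate.
have [W1 rW] := (network_stochastic hW, perron_fixed hr).
have [r1 r_gt0] := (perron_sum1 hr, perron_gt0 hr).
have n_gt0 : (0 < n)%N.
  rewrite lt0n; apply/eqP => n0; have := r1.
  rewrite big1 => [/eqP|i _]; first by rewrite eq_sym oner_eq0.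
  by have := ltn_ord i; rewrite {2}n0.
have ca0 : 0 < ca by rewrite invr_gt0.
have caL : ca * (L + mu) <= 1 by rewrite /ca mulVf// gt_eqF.
pose y := decay R.
have gl k : lambda g k = y k ^+ 5 by rewrite /= (poly_gain_decay 1 5) mul1r.
have gg k : gamma g k = y k ^+ 2 by rewrite /= (poly_gain_decay 1 2) mul1r.
have ga k : alpha g k = ca * y k ^+ 9 by rewrite /= (poly_gain_decay ca 9).
have gb k : beta g k = y k ^+ 7 by rewrite /= (poly_gain_decay 1 7) mul1r.
have b0 : beta g 0 = 1 by rewrite gb /y /decay powR1 expr1n.
have [rho0 rho1 contr scale] := contractive_norm_qf b0 hA.
(* [K] and [Ck] are fixed before any outcome is chosen, so the bound on kappa is uniform over
   [Om]. *)
have [K K0 HK] := y_bound W1 rW r1 r_gt0 rho0 rho1 contr scale (sqr_ge0 sigmay).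
have [Ck Ck0 HCk] := kappa_limit r1 r_gt0 K0 hepsk n_gt0.
pose Om : set T := [set w | forall k i,
  norm2 (\col_j tnth (noise_y e k i w) j) <= sigmay].
have OmN : P.-negligible (~` Om) by exact: noise_y_bounded he.
pose st k w := process W f epsk g x0 z0 e k w.
pose kap k w := st_kappa (st k w).
pose Y k w := st_y (st k w).
pose E k w : 'M[R]_n := \matrix_(i, j) tnth (noise_y e k i w) j.
have kapP w : Om w -> forall k i,
    `|kap k.+1 w i 0 - (n%:R * r i 0)^-1| <= Ck * y k ^+ 3.
  move=> Ow; apply: (HCk (Y ^~ w) (kap ^~ w)); split=> //.
  apply: (HK (E ^~ w)); split=> // [k i|k].
    have h := Ow k i.
    have -> : \sum_j E k w i j ^+ 2 = norm2 (\col_j tnth (noise_y e k i w) j) ^+ 2.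
      by rewrite norm2_sqr; apply: eq_bigr => j _; rewrite !mxE.
    by rewrite lerXn2r ?nnegrE ?norm2_ge0// (le_trans (norm2_ge0 _) h).
  rewrite -gl -gg /Y /lazy mulmxDl mul_scalar_mx -scalemxAl.
  by rewrite /st /process /= scalerDr !addrA.
pose Qn k : 'M[R]_n := lazy W (y k ^+ 7).
pose Nx k w := filtered Qn (scaled_noise (dev r) (noise_vec e true)) k w.
pose Nz k w := filtered Qn (scaled_noise (dev r) (noise_vec e false)) k w.
(* The scalar process [xi] is treated as a filter on column vectors of length 1, so that it shares
   the lemmas of the other two filters. *)
pose Qx k : 'M[R]_1 := (1 - ca * mu * y k ^+ 9)%:M.
pose xi1 k w := filtered Qx (scaled_noise r^T (noise_diff e)) k w.
pose pth w := Path (x ^~ w) (z ^~ w) (fun k => kap k.+1 w)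
  (noise_vec e true ^~ w) (noise_vec e false ^~ w) (Nx ^~ w) (Nz ^~ w)
  (fun k => xi1 k w 0 0).
have zE w k : z k.+1 w = lazy W (y k ^+ 7) *m z k w + y k ^+ 7 *: noise_vec e false k w
    + (ca * y k ^+ 9) *: pg f (pth w) k.
  by rewrite -gb -ga lazyE {1}/z /process /= scalerDr !addrA.
have xE w k : x k.+1 w = lazy W (y k ^+ 7) *m x k w + y k ^+ 7 *: noise_vec e true k w
    - (z k.+1 w - z k w).
  by rewrite -gb lazyE {1}/x /process /= scalerDr !addrA.
have hpath w : Om w -> is_path W r f mu ca Ck (pth w).
  move=> Ow; split=> //.
  - exact: zE.
  - exact: xE.
  - by rewrite /xi1 /= mxE.
  - move=> k; rewrite /xi1 /= -/(xi1 k w) /scaled_noise mul_scalar_mx mulmxBr /wavg.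
    set u1 := r^T *m _; set u2 := r^T *m _; set F := xi1 k w.
    by rewrite !mxE.
  - exact: kapP.
have rho2 : 0 < rho / 2 <= 1 by apply/andP; split; lra.
have rho01 : 0 < rho <= 1 by rewrite rho0.
have camu : 0 < ca * mu <= 1.
  rewrite mulr_gt0//=; apply: le_trans caL.
  by rewrite ler_wpM2l ?(ltW ca0)// lerDr ltW.
have Ndom b : dominated P Om (fun k w =>
    qf A (filtered Qn (scaled_noise (dev r) (noise_vec e b)) k w)) 7.
  apply: (filtered_noise_dominated (noise_vec_sqint he b)
    (@noise_vec_uncorrelated _ _ _ _ _ _ _ _ he b) Om rho01 (isT : (7 <= 9)%N)
    (erefl : (7 + 7 = 14)%N) (ltW hsigma) _ (noise_vec_var he b)) => k w.
  rewrite [rho * _]mulrC; apply: (qf_lazy contr); last exact: trmx_filtered.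
  by rewrite decayX_ge0 decayX_le1.
have xidom : dominated P Om (fun k w => xi1 k w 0 0 ^+ 2) 5.
  have s4 : 0 <= 4 * sigma by rewrite mulr_ge0// ltW.
  have D : dominated P Om (fun k w =>
      qf 1%:M (filtered Qx (scaled_noise r^T (noise_diff e)) k w)) 5.
    refine (filtered_noise_dominated (Q := Qx) (M := r^T) (B := 1%:M)
      (noise_diff_sqint he) (@noise_diff_uncorrelated _ _ _ _ _ _ _ _ he) Om camu
      (isT : (9 <= 9)%N) (erefl : (9 + 5 = 14)%N) s4 _ (noise_diff_var he)) => k w.
    rewrite -/(xi1 k w) /Qx mul_scalar_mx qfZ ler_wpM2r ?qf_ge0//.
    have [c0 c1] := andP camu.
    have h0 : 0 <= ca * mu * y k ^+ 9 by rewrite mulr_ge0 ?decayX_ge0// ltW.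
    have h1 : ca * mu * y k ^+ 9 <= 1 by rewrite mulr_ile1 ?decayX_ge0 ?decayX_le1// ltW.
    by rewrite expr2 ler_piMr ?subr_ge0// gerBl.
  by apply: dominated_le D => k w _; rewrite qf_scalar.
have [C1 C10 H1] := pu_rec rW r1 r_gt0 n_gt0 scale hmu hL ca0 caL
  hconvex hsmooth hxs Ck0.
have [C2 C20 H2] := pU_rec W1 rW r1 rho0 contr scale f mu ca Ck.
have [C3 C30 H3] := pZ_rec W1 rW r1 r_gt0 rho0 contr scale mu xs ca hL hsmooth Ck0.
pose V1 k w := pu r xs (pth w) k ^+ 2.
pose V2 k w := qf A (pU r (pth w) k).
pose V3 k w := qf A (pZ r (pth w) k).
have V10 k w : 0 <= V1 k w by exact: sqr_ge0.
have V20 k w : 0 <= V2 k w by exact: qf_ge0.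
have V30 k w : 0 <= V3 k w by exact: qf_ge0.
have I1 w : V1 0%N w <= (wavg r x0 - xs - (0 : 'cV[R]_1) 0 0) ^+ 2 by exact: lexx.
have I2 w : V2 0%N w <= qf A (dev r *m x0 + dev r *m z0 - 0) by exact: lexx.
have I3 w : V3 0%N w <= qf A (dev r *m z0 - 0) by exact: lexx.
have R1 k w (Ow : Om w) := H1 _ (hpath w Ow) k.
have R2 k w (Ow : Om w) := H2 _ (hpath w Ow) k.
have R3 k w (Ow : Om w) := H3 _ (hpath w Ow) k.
have D1 := V1_dominated camu rho2 C10 C20 C30 V10 V20 V30 xidom (Ndom true)
  (Ndom false) I1 I2 I3 R1 R2 R3.
have D2 := V2_dominated camu rho2 C10 C20 C30 V10 V20 V30 xidom (Ndom true)
  (Ndom false) I1 I2 I3 R1 R2 R3.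
have D3 := V3_dominated camu rho2 C10 C20 C30 V10 V20 V30 xidom (Ndom true)
  (Ndom false) I1 I2 I3 R1 R2 R3.
(* The only place where [eps] enters: 2/5 exceeds 1/3. *)
have rate4 : - (4%:R / 10) <= - 3^-1 + eps by lra.
have xi4 := dominated_weaken (isT : (4 <= 5)%N) xidom.
have Nx4 := dominated_weaken (isT : (4 <= 7)%N) (Ndom true).
have Nz4 := dominated_weaken (isT : (4 <= 7)%N) (Ndom false).
split; apply: (dominated_bigO OmN _ _ rate4).
- by move=> k w; rewrite subr_ge0; exact: hxs.
- have L2 : 0 <= 2 * L by rewrite mulr_ge0// ltW.
  apply: dominated_le (dominated_scale L2 (dominated_add D1 xi4)) => k w _.
  apply: (le_trans (avg_gap n_gt0 hL hsmooth hxs _)).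
  rewrite [2 * L]mulrC -mulrA ler_wpM2l ?(ltW hL)//.
  have -> : wavg r (x k w) - xs = pu r xs (pth w) k + xi1 k w 0 0.
    by rewrite /pu /= subrK.
  by rewrite /V1; have := sqr_ge0 (pu r xs (pth w) k - xi1 k w 0 0); nra.
- by move=> k w; exact: sqr_ge0.
- have D := dominated_add (dominated_add D2 D3) (dominated_add Nx4 Nz4).
  apply: dominated_le (dominated_scale (ler0n R 4) D) => k w _.
  by rewrite normA_sqr dev_wavg; exact: (qf_dev_px r A (pth w) k).
- by move=> k w; exact: sqr_ge0.
- apply: dominated_le (dominated_scale (ler0n R 2) (dominated_add D3 Nz4)) => k w _.
  by rewrite normA_sqr dev_wavg; exact: (qf_dev_pz r A (pth w) k).
Qed.
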